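(* Let $0<\lambda<2$ and $f_\lambda(z)=\lambda e^z+z+\lambda$. Then the Fatou set of $f_\lambda$ is the union of infinitely many attracting domains and their iterated preimages. In particular, $f_\lambda$ has no Baker wandering domain.
   Context: Write $\widehat{\mathbb{C}}=\mathbb{C}\cup\{\infty\}$. The Fatou set $\mathcal{F}(f)$ of an entire function $f$ is the set of points in a neighborhood of which the iterates $\{f^n\}_{n>0}$ are defined and form a normal family; a Fatou component is a connected component of $\mathcal{F}(f)$. For a Fatou component $U$, $U_n$ denotes the Fatou component containing $f^n(U)$. $U$ is periodic if $U_p=U$ for some $p\ge 1$, pre-periodic if it is not periodic but $U_k$ is periodic for some $k>0$, and a wandering domain if it is neither periodic nor pre-periodic. An attracting domain is a periodic Fatou component containing an attracting periodic point, i.e. a component of the immediate basin of attraction of an attracting periodic point. An iterated preimage of a Fatou component $U$ is a Fatou component $U'$ with $U'_n=U$ for some $n>0$. A wandering domain $W$ is a Baker wandering domain if each $W_n$ is bounded, there is a natural number $N$ such that $W_{n+1}$ surrounds $W_n$ and $0$ for all $n\ge N$, and $\mathrm{dist}(W_n,0)\to\infty$ as $n\to\infty$. Here $W_{n+1}$ surrounds $W_n$ (or $0$) if a bounded component of $\widehat{\mathbb{C}}\setminus W_{n+1}$ contains $W_n$ (or $0$), and $\mathrm{dist}$ is Euclidean distance. *)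

(* Defs.v *)
From HB Require Import structures.
From mathcomp Require Import all_boot all_order all_algebra.
From mathcomp Require Import all_classical all_reals all_analysis.
From mathcomp Require Import complex.

Set Implicit Arguments.
Unset Strict Implicit.
Unset Printing Implicit Defensive.

Import Order.TTheory GRing.Theory Num.Theory.
Import numFieldNormedType.Exports.

Local Open Scope classical_set_scope.
Local Open Scope complex_scope.
Local Open Scope ring_scope.

(* The ascription to numClosedFieldType gives the plane the topology and the
   normed module structure that MathComp-Analysis puts on a numFieldType;
   neither is inferred on R[i] itself. *)
Definition plane (R : realType) : numClosedFieldType := R[i].

(* Some z is the finite point z, None is the point at infinity. *)
Definition sphere (R : realType) : topologicalType :=
  one_point_compactification (plane R).

Section Dynamics.
Variable R : realType.
Local Notation C := (plane R).
Local Notation S := (sphere R).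
Local Notation normc := (@Normc.normc R).

(* MathComp's norm on R[i] takes its values in R[i]; normc is the same
   modulus, valued in R. *)

Definition chordal (p q : S) : R :=
  match p, q with
  | Some z, Some w => 2 * normc (z - w) /
      (Num.sqrt (1 + normc z ^+ 2) * Num.sqrt (1 + normc w ^+ 2))
  | Some z, None | None, Some z => 2 / Num.sqrt (1 + normc z ^+ 2)
  | None, None => 0
  end.

(* Normality in the sense of Montel with respect to the spherical metric:
   the limit g is allowed to take the value infinity, and only its values on
   U matter. *)
Definition normal_family (U : set C) (F : set (C -> C)) : Prop :=
  forall u : nat -> (C -> C), (forall n, F (u n)) ->
  exists2 s : nat -> nat, {homo s : m n / (m < n)%N} &
  exists g : C -> S, forall K : set C, compact K -> K `<=` U ->
  forall e : R, 0 < e ->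
    \forall k \near \oo, forall z, K z -> chordal (Some (u (s k) z)) (g z) < e.

Definition iterates (f : C -> C) : set (C -> C) :=
  [set g | exists2 n, (0 < n)%N & g = iter n f].

Definition Fatou (f : C -> C) : set C :=
  [set z | exists U : set C,
    [/\ open U, U z & normal_family U (iterates f)]].

Definition Fatou_component (f : C -> C) (U : set C) : Prop :=
  exists2 z, Fatou f z & U = connected_component (Fatou f) z.

(* V = U_n. *)
Definition is_nth_component (f : C -> C) (U : set C) (n : nat) (V : set C) :
    Prop :=
  Fatou_component f V /\ iter n f @` U `<=` V.

Definition periodic_component (f : C -> C) (U : set C) : Prop :=
  Fatou_component f U /\ exists2 p, (1 <= p)%N & is_nth_component f U p U.

Definition preperiodic_component (f : C -> C) (U : set C) : Prop :=
  [/\ Fatou_component f U, ~ periodic_component f U &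
    exists k V, [/\ (0 < k)%N, is_nth_component f U k V &
                    periodic_component f V]].

Definition wandering_domain (f : C -> C) (U : set C) : Prop :=
  [/\ Fatou_component f U, ~ periodic_component f U &
    ~ preperiodic_component f U].

(* is_derive z 1 is the complex derivative, C being a module over itself. *)
Definition attracting_periodic_point (f : C -> C) (z : C) : Prop :=
  exists p : nat, [/\ (1 <= p)%N, iter p f z = z &
    exists2 mu : C, is_derive z (1 : C) (iter p f : C -> C) mu & `|mu| < 1].

Definition attracting_domain (f : C -> C) (U : set C) : Prop :=
  periodic_component f U /\ exists2 z, U z & attracting_periodic_point f z.

Definition iterated_preimage (f : C -> C) (U U' : set C) : Prop :=
  [/\ Fatou_component f U, Fatou_component f U' &
    exists2 n, (0 < n)%N & is_nth_component f U' n U].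

(* A bounded component of S \ V contains A; being bounded means lying in a
   bounded subset of the plane, hence away from infinity. *)
Definition surrounds (V A : set C) : Prop :=
  let coV : set S := ~` (Some @` V) in
  exists2 p : S, coV p &
    (exists2 B : set C, bounded_set B & connected_component coV p `<=` Some @` B)
    /\ Some @` A `<=` connected_component coV p.

Definition dist0 (A : set C) : R := inf [set normc z | z in A].

Definition Baker_wandering_domain (f : C -> C) (W : set C) : Prop :=
  wandering_domain f W /\
  exists Wn : nat -> set C,
    [/\ forall n, is_nth_component f W n (Wn n),
        forall n, bounded_set (Wn n),
        exists N : nat, forall n, (N <= n)%N ->
          surrounds (Wn n.+1) (Wn n) /\ surrounds (Wn n.+1) [set 0] &
        dist0 (Wn n) @[n --> \oo] --> +oo].

Definition cexp (z : C) : C :=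
  (expR (complex.Re z) * cos (complex.Im z))
    +i* (expR (complex.Re z) * sin (complex.Im z)).

Definition f_ (lambda : R) (z : C) : C :=
  (lambda%:C : C) * cexp z + z + (lambda%:C : C).

End Dynamics.

(* Main.v *)
Require Import Defs.
From mathcomp Require Import all_boot all_order all_algebra.
From mathcomp Require Import all_classical all_reals all_analysis.
From mathcomp Require Import complex.
From mathcomp Require Import cyclic separable cyclotomic ring lra zify.
Set Implicit Arguments.
Unset Strict Implicit.
Unset Printing Implicit Defensive.

Import Order.TTheory GRing.Theory Num.Theory.
Import numFieldNormedType.Exports.
Local Open Scope classical_set_scope.
Local Open Scope ring_scope.

(** The map [f = f_ lambda] commutes with translation by [2 pi i], and its fixed
    points [p_k = (2k+1) pi i] all have multiplier [1 - lambda], of modulus less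
    than 1.  The point of the proof is that the Fatou set is exactly the union
    [A] of the basins of the [p_k] ([FatouE]).  Since the basins are open and
    pairwise disjoint, a Fatou component then lies in a single basin, and some
    iterate sends it into the component containing [p_k]
    ([eventually_immediate]); so nothing wanders at all.

    [A] lies in the Fatou set because [f] contracts near [p_k].  The converse
    rests on the density of [A] ([basins_dense]).  Suppose that a disc around
    [z0] misses [A].

    - The lines [Im z = (2k+1) pi] are invariant and lie in [A]
      ([line_basins]): there [u = e^x] moves by the Ricker map
      [u e^(lambda (1 - u))], under which [|u - 1|] decreases when
      [lambda < 2].  So each [f^n] maps the disc into a horizontal strip of
      width [2 pi], and the Borel-Caratheodory inequality bounds
      [|(f^n)'(z0)|] by a constant times the distance from [f^n z0] to the edge
      of the strip ([dprod_bound]).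
    - [f] never contracts the hyperbolic metric of these strips, whose density
      is proportional to [1 / cos (Im z / 2)].  Quantitatively
      ([f_expands]), with [c = cos^2 (Im z / 2)] and [s = lambda e^(Re z)], the
      gain at each step is controlled by [c^2 (2s + s^2)]; this inequality is
      the second order Taylor bound of the cosine in disguise.
    - The two together force [c^2 (2s + s^2)] to tend to 0 along the orbit of
      [z0].  By compactness [c] is bounded below off [A] while
      [lambda/2 <= s <= e^(lambda+1)], so [s] eventually avoids this window; but
      from above the window [s] falls below it, and from below it grows
      geometrically and is too slow to jump over it ([escape_absurd]).

    Given density, let [z0] be in the Fatou set.  A limit function takes
    only values [p_k] on [A], and these are isolated in the spherical metric, so
    a late iterate cannot change its nearest [p_k] along a short segment from
    [z0] to a point of [A]; hence [z0] itself is attracted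
    ([Fatou_sub_basins]).

    For polynomials, the Borel-Caratheodory inequality follows from averages
    over roots of unity ([coef_average]), and it passes to functions that are uniform limits of
    polynomials on discs ([approximable]), a class that contains the
    exponential and is closed under composition. *)

Local Open Scope complex_scope.
Local Notation normc := Normc.normc.
Local Notation Re := complex.Re.
Local Notation Im := complex.Im.

(** * Elementary bounds for sine, cosine and exponential *)

Section RealEstimates.
Context {R : realType}.
Implicit Types x y a t s : R.

Lemma ler_dist_sin x y : `|sin x - sin y| <= `|x - y|.
Proof.
wlog xy : x y / y <= x.
  move=> H; case/orP: (le_total y x) => h; first exact: H.
  by rewrite distrC (distrC x); exact: H.
have [c _ ->] := MVT_segment xy (fun z _ => is_derive_sin z)
  (continuous_subspaceT (@continuous_sin R)).
by rewrite normrM ler_piMl// ler_norml cos_geN1 cos_le1.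
Qed.

(** The only Taylor estimate used below: translates of it by multiples of [pi / 2]
    give all the other bounds on sine and cosine. *)
Lemma cos_taylor2 y a : cos (y + a) <= cos y - a * sin y + a ^+ 2 / 2.
Proof.
wlog a0 : y a / 0 <= a.
  move=> H; case/orP: (le_total 0 a) => a0; first exact: H.
  have := H (- y) (- a); rewrite -opprD !cosN sinN sqrrN mulrNN; apply.
  by rewrite oppr_ge0.
pose g t : R := cos (y + t) + t * sin y - t ^+ 2 / 2.
pose dg t : R := - sin (y + t) + sin y - t.
have dgE t : is_derive t 1 g (dg t).
  rewrite /g /dg; apply: is_derive_eq.
  rewrite /GRing.scale /= !(mulr1, mulr0, mul1r, add0r, addr0, subr0, scale0r).
  by field.
have gc : {within `[0, a], continuous g}.
  apply: continuous_subspaceT => x; apply: differentiable_continuous.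
  by apply/derivable1_diffP; case: (dgE x).
have [c] := MVT_segment a0 (fun x _ => dgE x) gc.
rewrite in_itv/= => /andP[c0 ca].
rewrite {1 2}/g addr0 mul0r addr0 expr0n/= mul0r subr0 => E.
suff : dg c * (a - 0) <= 0 by rewrite -E; lra.
rewrite subr0 mulr_le0_ge0// /dg.
have := ler_dist_sin y (y + c); rewrite opprD addrA subrr add0r normrN (ger0_norm c0).
by have := ler_norm (sin y - sin (y + c)); lra.
Qed.

Lemma cos_ge1B a : 1 - a ^+ 2 / 2 <= cos a.
Proof. by have := cos_taylor2 pi a; rewrite addrC cosDpi cospi sinpi mulr0; lra. Qed.

Lemma sin_dist_le a : `|sin a - a| <= a ^+ 2 / 2.
Proof.
have := cos_taylor2 (- (pi / 2)) a; rewrite addrC cosBpihalf cosN cos_pihalf sinN sin_pihalf.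
have := cos_taylor2 (pi / 2) a; rewrite addrC cosDpihalf cos_pihalf sin_pihalf.
by rewrite ler_norml => *; apply/andP; split; lra.
Qed.

Lemma expR_dist_le x : `|x| <= 2^-1 -> `|expR x - 1 - x| <= 2 * x ^+ 2.
Proof.
rewrite ler_norml => /andP[x1 x2].
have h1 := expR_ge1Dx x; have h2 := expR_ge1Dx (- x).
have h3 := expR_gt0 x.
have h4 : expR x * expR (- x) = 1 by rewrite -expRD subrr expR0.
have h5 : expR x * (1 - x) <= 1 by rewrite -[leRHS]h4 ler_pM2l.
have h6 : expR x <= 1 + x + 2 * x ^+ 2.
  have x1' : 0 < 1 - x by lra.
  have xx : 0 <= x ^+ 2 * (1 - 2 * x) by rewrite mulr_ge0 ?sqr_ge0//; lra.
  by rewrite -(ler_pM2r x1'); lra.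
have xx := sqr_ge0 x.
by rewrite ler_norml; apply/andP; split; lra.
Qed.

(** Turns the distance to the edge of a strip into the quantity [1 + cos (Im z)] that
    measures expansion. *)
Lemma sqr_le_1Bcos t : 0 <= t <= pi -> t ^+ 2 <= 32 * (1 - cos t).
Proof.
move=> /andP[t0 tpi].
have small (u : R) : 0 <= u <= 2 -> u ^+ 2 <= 8 * (1 - cos u).
  move=> /andP[u0 u2].
  have := sin_dist_le (u / 2); rewrite ler_norml => /andP[h _].
  have h2 : u / 4 <= sin (u / 2) by nra.
  have -> : cos u = 1 - 2 * sin (u / 2) ^+ 2.
    have -> : cos u = cos (u / 2 + u / 2) by congr cos; lra.
    by rewrite cosD -!expr2 cos2sin2; lra.
  by nra.
have [t2|t2] := leP t 2; first by have := small t; rewrite t0 t2 => /(_ isT); nra.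
have h2 : cos t <= cos 2.
  by apply/ltW; rewrite ltr_cos// in_itv/= ?t0 ?tpi// ler0n (le_trans (ltW t2)).
have := small 2; rewrite lexx ler0n => /(_ isT) h3.
have hp : pi <= 4 :> R by have := pihalf_lt2 R; lra.
by nra.
Qed.

End RealEstimates.

(** * The complex plane and the complex exponential *)

Section Plane.
Context {R : realType}.
Local Notation C := (plane R).
Implicit Types z w : C.

Lemma ReD z w : Re (z + w) = Re z + Re w. Proof. by case: z w => [? ?] []. Qed.
Lemma ImD z w : Im (z + w) = Im z + Im w. Proof. by case: z w => [? ?] []. Qed.
Lemma ReN z : Re (- z) = - Re z. Proof. by case: z. Qed.
Lemma ImN z : Im (- z) = - Im z. Proof. by case: z. Qed.
Lemma ReM z w : Re (z * w) = Re z * Re w - Im z * Im w.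
Proof. by case: z w => [? ?] []. Qed.
Lemma ImM z w : Im (z * w) = Re z * Im w + Im z * Re w.
Proof. by case: z w => [? ?] []. Qed.

Lemma plane_eqP z w : Re z = Re w -> Im z = Im w -> z = w.
Proof. by case: z w => [? ?] [? ?] /= -> ->. Qed.

Lemma plane_normE z : `|z| = (normc z)%:C :> C.
Proof. by []. Qed.

Lemma sqr_normc z : normc z ^+ 2 = Re z ^+ 2 + Im z ^+ 2.
Proof. by case: z => a b /=; rewrite sqr_sqrtr// addr_ge0 ?sqr_ge0. Qed.

Lemma normc_ge0 z : 0 <= normc z.
Proof. by case: z => a b; exact: sqrtr_ge0. Qed.

Lemma le_normcD z w : normc (z + w) <= normc z + normc w.
Proof. by rewrite -lecR rmorphD; exact: (ler_normD (z : C) w). Qed.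

Lemma normcN z : normc (- z) = normc z.
Proof. by case: z => a b /=; rewrite !sqrrN. Qed.

Lemma normcBC z w : normc (z - w) = normc (w - z).
Proof. by rewrite -normcN opprB. Qed.

Lemma le_normcB z w : normc (z - w) <= normc z + normc w.
Proof. by rewrite (le_trans (le_normcD _ _))// normcN. Qed.

Lemma le_normc_tri z u w : normc (z - w) <= normc (z - u) + normc (u - w).
Proof. by have := le_normcD (z - u) (u - w); rewrite addrA subrK. Qed.

Lemma normcM z w : normc (z * w) = normc z * normc w.
Proof. exact: Normc.normcM. Qed.

Lemma normcX z n : normc (z ^+ n) = normc z ^+ n.
Proof.
elim: n => [|n IH]; first by rewrite !expr0; exact: Normc.normc1.
by rewrite !exprS normcM IH.
Qed.

Lemma normc_real (x : R) : normc (x%:C : C) = `|x|.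
Proof. by rewrite /= expr0n addr0 sqrtr_sqr. Qed.

Lemma normc_sum (I : Type) (r : seq I) (P : pred I) (F : I -> C) :
  normc (\sum_(i <- r | P i) F i) <= \sum_(i <- r | P i) normc (F i).
Proof.
elim/big_ind2 : _ => [|z a w b za wb|//].
  by rewrite Normc.normc0.
by rewrite (le_trans (le_normcD _ _))// lerD.
Qed.

Lemma normc_eq0 z : normc z = 0 -> z = 0.
Proof. exact: Normc.eq0_normc. Qed.

Lemma normc0 : normc (0 : C) = 0.
Proof. exact: Normc.normc0. Qed.

Lemma normr_Re_le z : `|Re z| <= normc z.
Proof.
by rewrite -ler_sqr ?nnegrE ?normc_ge0// sqr_normc real_normK ?num_real// lerDl sqr_ge0.
Qed.

Lemma normr_Im_le z : `|Im z| <= normc z.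
Proof.
by rewrite -ler_sqr ?nnegrE ?normc_ge0// sqr_normc real_normK ?num_real// lerDr sqr_ge0.
Qed.

Lemma normc_le_ReIm z : normc z <= `|Re z| + `|Im z|.
Proof.
rewrite -ler_sqr ?nnegrE ?normc_ge0 ?addr_ge0// sqr_normc sqrrD.
by rewrite !real_normK ?num_real// -addrA lerD2l lerDr mulrn_wge0.
Qed.

Lemma cexp0 : cexp (0 : C) = 1.
Proof. by apply: plane_eqP; rewrite /= expR0 ?cos0 ?sin0 ?mulr1 ?mulr0. Qed.

Lemma cexpD z w : cexp (z + w) = cexp z * cexp w.
Proof.
by apply: plane_eqP; rewrite ?ReM ?ImM /= ReD ImD expRD ?cosD ?sinD; ring.
Qed.

Lemma cexpM n z : cexp (z *+ n) = cexp z ^+ n.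
Proof. by elim: n => [|n IH]; rewrite ?mulr0n ?cexp0// mulrS exprS cexpD IH. Qed.

Lemma normc_cexp z : normc (cexp z) = expR (Re z).
Proof.
apply/eqP; rewrite -(@eqrXn2 _ 2) ?normc_ge0 ?expR_ge0//; apply/eqP.
by rewrite sqr_normc/= !exprMn -mulrDr cos2Dsin2 mulr1.
Qed.

Lemma cexp_dist_le w : normc w <= 2^-1 ->
  normc (cexp w - 1 - w) <= 3 * normc w ^+ 2.
Proof.
move=> w2; set x := Re w; set y := Im w.
have x2 : `|x| <= 2^-1 by apply: le_trans w2; exact: normr_Re_le.
have y2 : `|y| <= 2^-1 by apply: le_trans w2; exact: normr_Im_le.
have hx := expR_dist_le x2.
have e2 : expR x <= 2.
  move: hx x2; rewrite !ler_norml => /andP[_ hx] /andP[? ?].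
  have : (2^-1 - x) * (2^-1 + x) >= 0 by rewrite mulr_ge0//; lra.
  by lra.
apply: (le_trans (normc_le_ReIm _)); rewrite sqr_normc !(ReD,ReN,ImD,ImN) -/x -/y.
have -> : Re (cexp w) - Re (1 : C) - x = (expR x - 1 - x) + expR x * (cos y - 1).
  by rewrite /=; ring.
have -> : Im (cexp w) - Im (1 : C) - y = expR x * (sin y - y) + (expR x - 1) * y.
  by rewrite /=; ring.
have h1 : `|expR x * (cos y - 1)| <= y ^+ 2.
  rewrite normrM ger0_norm ?expR_ge0// ler0_norm ?subr_le0 ?cos_le1//.
  have := cos_ge1B y; have := cos_le1 y => c1 c2.
  have : expR x * - (cos y - 1) <= 2 * (- (cos y - 1)) by rewrite ler_wpM2r//; lra.
  by lra.
have h2 : `|expR x * (sin y - y)| <= y ^+ 2.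
  rewrite normrM ger0_norm ?expR_ge0//.
  have := sin_dist_le y => s1.
  have : expR x * `|sin y - y| <= 2 * `|sin y - y| by rewrite ler_wpM2r.
  by lra.
have h3 : `|(expR x - 1) * y| <= x ^+ 2 + y ^+ 2.
  rewrite normrM.
  have : `|expR x - 1| <= 2 * `|x|.
    have := ler_normD (expR x - 1 - x) x; rewrite subrK => h.
    have : `|x| * `|x| <= `|x| * 2^-1 by rewrite ler_wpM2l.
    by rewrite -expr2 real_normK ?num_real//; lra.
  move=> /(ler_wpM2r (normr_ge0 y)) h.
  have := sqr_ge0 (`|x| - `|y|); rewrite sqrrB !real_normK ?num_real//.
  by lra.
have := ler_normD (expR x - 1 - x) (expR x * (cos y - 1)).
have := ler_normD (expR x * (sin y - y)) ((expR x - 1) * y).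
by lra.
Qed.

End Plane.

(** * Averages over roots of unity *)

Section BorelCaratheodory.
Context {R : realType}.
Local Notation C := (plane R).
Implicit Types (z w : C) (p : {poly C}).

Lemma prim_root_exists n : (0 < n)%N -> exists z : C, n.-primitive_root z.
Proof.
move=> n0; have [r] := closed_field_poly_normal ('X^n - 1 : {poly C}).
rewrite (monicP (monicXnsubC 1 n0)) scale1r => Er.
have r1 : all n.-unity_root r.
  by apply/allP => z zr; rewrite /root_of_unity Er root_prod_XsubC.
have ur : uniq r.
  by rewrite -separable_prod_XsubC -Er separable_Xn_sub_1// pnatr_eq0 -lt0n.
have sr : (n <= size r)%N.
  by rewrite -ltnS -(size_prod_XsubC r id) -Er size_XnsubC.
by have /hasP[z _ zn] := has_prim_root n0 r1 ur sr; exists z.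
Qed.

Lemma normc_prim_root n (omega : C) : n.-primitive_root omega -> normc omega = 1.
Proof.
move=> om; have n0 := prim_order_gt0 om; apply/eqP.
rewrite -(pexpr_eq1 n0 (normc_ge0 _)) -normcX (prim_expr_order om).
by apply/eqP; exact: Normc.normc1.
Qed.

(** Keeps all exponents of [omega] in the naturals. *)
Lemma conj_prim_root n (omega : C) : n.-primitive_root omega ->
  omega^*%R = omega ^+ n.-1.
Proof.
move=> om; have n0 := prim_order_gt0 om.
have o1 : omega * omega^*%R = 1.
  by rewrite -normCK plane_normE (normc_prim_root om) expr1n.
by rewrite -[LHS]mul1r -(prim_expr_order om) -{1}(prednK n0) exprSr -mulrA o1 mulr1.
Qed.

Lemma sum_prim_root n (omega : C) e : n.-primitive_root omega ->
  \sum_(j < n) omega ^+ (j * e) = if (n %| e)%N then n%:R else 0.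
Proof.
move=> om; under eq_bigr do rewrite mulnC exprM.
case: ifPn => ne.
  have -> : omega ^+ e = 1 by apply/eqP; rewrite -(prim_order_dvd om).
  by under eq_bigr do rewrite expr1n; rewrite sumr_const card_ord.
have : (omega ^+ e - 1) * \sum_(j < n) (omega ^+ e) ^+ j = 0.
  by rewrite -subrX1 exprAC (prim_expr_order om) expr1n subrr.
move=> /eqP; rewrite mulf_eq0 subr_eq0 -(prim_order_dvd om) (negbTE ne) /=.
by move/eqP.
Qed.

Lemma add_conjE z : z + z^*%R = (2 * Re z)%:C.
Proof. by case: z => a b; apply: plane_eqP; rewrite ?(ReD, ImD) /=; ring. Qed.

Lemma conj_realE (x : R) : (x%:C : C)^*%R = x%:C.
Proof. by apply: plane_eqP; rewrite //= oppr0. Qed.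

Lemma conj_term z w (x : R) j k :
  (z * (x%:C * w ^+ j) ^+ k)^*%R = z^*%R * (x%:C * (w^*%R) ^+ j) ^+ k.
Proof.
rewrite rmorphM rmorphXn rmorphM rmorphXn; congr (_ * (_ * _) ^+ _).
exact: conj_realE.
Qed.

(** A coefficient of [p] from the real parts of [p] on a circle: averaging [p] against
    [omega ^ (- j m)] isolates the coefficient of index [m], and averaging the
    conjugate of [p] gives 0 because [0 < k + m < N] for all indices [k]; so [p] may
    be replaced by [p] plus its conjugate. *)
Lemma coef_average p n N (omega : C) (rho : R) m :
  (size p <= n)%N -> (n.*2 <= N)%N -> (0 < m < n)%N -> N.-primitive_root omega ->
  N%:R * (p`_m * rho%:C ^+ m) =
  \sum_(j < N) (2 * Re p.[rho%:C * omega ^+ j])%:C * omega ^+ (j * (N.-1 * m)).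
Proof.
move=> sp nN /andP[m0 mn] om; have N0 := prim_order_gt0 om.
have dvdE k : (k < n)%N -> (N %| k + N.-1 * m)%N = (k == m).
  move=> kn; have mN : (m < N)%N by rewrite (leq_trans mn)// (leq_trans _ nN)// -addnn leq_addr.
  have kN : (k < N)%N by rewrite (leq_trans kn)// (leq_trans _ nN)// -addnn leq_addr.
  rewrite -[LHS]/((k + N.-1 * m) %% N == 0)%N -(mod0n N) -(eqn_modDr m) add0n -addnA.
  have -> : (N.-1 * m + m = m * N)%N by rewrite addnC -mulSn prednK// mulnC.
  by rewrite addnC modnMDl !modn_small.
have dvdE' k : (k < n)%N -> (N %| N.-1 * k + N.-1 * m)%N = false.
  move=> kn; rewrite -mulnDr Gauss_dvdr; last by rewrite coprime_sym coprimePn.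
  rewrite gtnNdvd// ?addn_gt0 ?m0 ?orbT//.
  by rewrite (leq_trans _ nN)// -addnn; rewrite -addnS leq_add// ltnW.
transitivity (\sum_(j < N) \sum_(k < n)
    (p`_k * rho%:C ^+ k * omega ^+ (j * (k + N.-1 * m)) +
     (p`_k)^*%R * rho%:C ^+ k * omega ^+ (j * (N.-1 * k + N.-1 * m)))); last first.
  apply: eq_bigr => j _; rewrite -add_conjE mulrDl (horner_coef_wide _ sp).
  have -> : (\sum_(k < n) p`_k * (rho%:C * omega ^+ j) ^+ k)^*%R =
      \sum_(k < n) (p`_k)^*%R * (rho%:C * (omega^*%R) ^+ j) ^+ k.
    by rewrite rmorph_sum; apply: eq_bigr => k _; exact: conj_term.
  rewrite !mulr_suml -big_split/=; apply: eq_bigr => k _.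
  rewrite (conj_prim_root om) !exprMn -!exprM.
  by rewrite !mulnDr !exprD !mulrA; congr (_ * _ * _ + _ * _ * _); congr (_ ^+ _); lia.
rewrite exchange_big/=.
under eq_bigr do rewrite big_split/= -!mulr_sumr !(sum_prim_root _ om).
rewrite (bigD1 (Ordinal mn))//= dvdE// eqxx dvdE'// mulr0 addr0 mulrC.
rewrite big1 ?addr0// => k km; rewrite dvdE// dvdE'// mulr0 addr0.
by rewrite (_ : (k == m :> nat) = false) ?mulr0//; apply/negbTE; rewrite -(inj_eq val_inj) in km.
Qed.

End BorelCaratheodory.

(** * The Borel-Caratheodory inequality *)

Section BorelCaratheodoryBound.
Context {R : realType}.
Local Notation C := (plane R).
Implicit Types (z w : C) (p : {poly C}) (h : C -> C).

Lemma Re_sum (I : Type) (r : seq I) (P : pred I) (F : I -> C) :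
  Re (\sum_(i <- r | P i) F i) = \sum_(i <- r | P i) Re (F i).
Proof. by elim/big_rec2 : _ => [//|i a b _ <-]; rewrite ReD. Qed.

Lemma normc_nat n : normc (n%:R : C) = n%:R.
Proof. by rewrite -[n%:R](rmorph_nat (real_complex R)) normc_real normr_nat. Qed.

(** Since the real parts are nonnegative, the modulus of their weighted average is at
    most their plain average, which is the real part of [p.[0]]. *)
Lemma coef_le_Re p (rho : R) m : 0 < rho ->
  (forall z, normc z = rho -> 0 <= Re p.[z]) -> (0 < m)%N ->
  normc p`_m * rho ^+ m <= 2 * Re p`_0.
Proof.
move=> rho0 p0 m0.
pose n := (m + size p).+1; have N0 : (0 < n.*2)%N by rewrite double_gt0.
have [omega om] := @prim_root_exists R _ N0.
have n0 : (0 : R) < n.*2%:R by rewrite ltr0n.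
have on j : normc (omega ^+ j) = 1 by rewrite normcX (normc_prim_root om) expr1n.
have rn j : normc (rho%:C * omega ^+ j) = rho.
  by rewrite normcM on mulr1 normc_real gtr0_norm.
have sp : (size p <= n)%N by rewrite /n; lia.
have mn : (0 < m < n)%N by rewrite m0 /n; lia.
have := coef_average rho sp (leqnn _) mn om => /(congr1 (@Normc.normc R)).
rewrite !normcM normc_nat normcX normc_real gtr0_norm// => E.
rewrite -(ler_pM2l n0) E (le_trans (normc_sum _ _ _))//.
under eq_bigr => j _ do rewrite normcM on mulr1 normc_real ger0_norm ?mulr_ge0 ?p0//.
rewrite -mulr_sumr -Re_sum.
have -> : \sum_(j < n.*2) p.[rho%:C * omega ^+ j] = n.*2%:R * p`_0.
  under eq_bigr do rewrite (horner_coef_wide _ sp).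
  rewrite exchange_big/=.
  transitivity (\sum_(k < n) p`_k * rho%:C ^+ k * (\sum_(j < n.*2) omega ^+ (j * k))).
    apply: eq_bigr => k _; rewrite mulr_sumr; apply: eq_bigr => j _.
    by rewrite exprMn -exprM mulrA.
  under eq_bigr do rewrite (sum_prim_root _ om).
  rewrite big_ord_recl [nat_of_ord ord0]/= dvdn0 expr0 mulr1 mulrC big1 ?addr0// => k _.
  rewrite lift0 gtnNdvd ?mulr0//.
  by have := ltn_ord k; rewrite -addnn; lia.
rewrite ReM.
have -> : Re (n.*2%:R : C) = n.*2%:R by rewrite -[n.*2%:R](rmorph_nat (real_complex R)).
have -> : Im (n.*2%:R : C) = 0 by rewrite -[n.*2%:R](rmorph_nat (real_complex R)).
by rewrite mul0r subr0; lra.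
Qed.

(** Sum of the geometric series given by the coefficient bounds. *)
Lemma poly_borel_caratheodory p (rho : R) z : 
  (forall w, normc w = rho -> 0 <= Re p.[w]) -> normc z < rho ->
  normc (p.[z] - p.[0]) <= 2 * Re p.[0] * (normc z / (rho - normc z)).
Proof.
move=> p0 zrho; have t0 := normc_ge0 z; set t := normc z in zrho t0 *.
have rho0 : 0 < rho by exact: le_lt_trans zrho.
have x0 : 0 <= t / rho by rewrite divr_ge0// ltW.
have x1 : t / rho < 1 by rewrite ltr_pdivrMr// mul1r.
have cb m : normc p`_m.+1 * t ^+ m.+1 <= 2 * Re p`_0 * (t / rho) ^+ m.+1.
  have := coef_le_Re rho0 p0 (ltn0Sn m).
  rewrite -(ler_pM2r (_ : 0 < rho ^- m.+1)) ?invr_gt0 ?exprn_gt0//.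
  rewrite mulfK ?gt_eqF ?exprn_gt0// => /(ler_wpM2r (exprn_ge0 m.+1 t0)) h.
  by rewrite expr_div_n (le_trans h)// [leRHS]mulrA [leLHS]mulrAC.
have a0 : 0 <= 2 * Re p`_0.
  apply: le_trans (coef_le_Re rho0 p0 (ltn0Sn 0)).
  by rewrite mulr_ge0 ?normc_ge0 ?exprn_ge0// ltW.
rewrite horner_coef0 (@horner_coef_wide _ (size p).+1)// big_ord_recl/= expr0 mulr1.
rewrite addrC addrA addNr add0r (le_trans (normc_sum _ _ _))//.
apply: (@le_trans _ _ (\sum_(k < size p) 2 * Re p`_0 * (t / rho) ^+ k.+1)).
  by apply: ler_sum => k _; rewrite normcM normcX; exact: cb.
rewrite -mulr_sumr ler_wpM2l//.
have -> : t / (rho - t) = (t / rho) / (1 - t / rho).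
  by field; rewrite !gt_eqF//; lra.
rewrite ler_pdivlMr ?subr_gt0//.
under eq_bigr do rewrite exprS.
rewrite -mulr_sumr -mulrA ler_piMr// -[_ * (1 - _)]opprK -mulrN opprB mulrC -subrX1.
by rewrite opprB lerBlDr lerDl exprn_ge0.
Qed.

(** By Runge's theorem these are the entire functions; in this form,
    inequalities between values of polynomials pass to them. *)
Definition approximable h := forall (B e : R), 0 < e ->
  exists p, forall z, normc z <= B -> normc (h z - p.[z]) <= e.

Lemma borel_caratheodory h (rho : R) z0 z : approximable h ->
  (forall w, normc (w - z0) <= rho -> 0 <= Re (h w)) -> normc (z - z0) < rho ->
  normc (h z - h z0) <=
    2 * Re (h z0) * (normc (z - z0) / (rho - normc (z - z0))).
Proof.
move=> happ h0 zrho; set t := normc (z - z0) in zrho *.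
have t0 : 0 <= t by exact: normc_ge0.
set K := t / (rho - t).
have K0 : 0 <= K by rewrite divr_ge0// subr_ge0 ltW.
apply/ler_addgt0Pr => e e0; set e' := e / (2 + 4 * K).
have d0 : 0 < 2 + 4 * K by lra.
have e'0 : 0 < e' by rewrite divr_gt0.
have [p hp] := happ (normc z0 + rho) e' e'0.
(* Recentre at [z0] and add [e'] to restore a nonnegative real part. *)
pose q := (p \Po ('X + z0%:P)) + (e'%:C)%:P.
have qE w : q.[w] = p.[w + z0] + e'%:C by rewrite /q !hornerE horner_comp !hornerE.
have hpw w : normc (w - z0) <= rho -> normc (h w - p.[w]) <= e'.
  move=> wr; apply: hp; have := le_normcD (w - z0) z0; rewrite subrK => /le_trans; apply.
  by lra.
have hRe w : normc (w - z0) <= rho -> `|Re (h w) - Re p.[w]| <= e'.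
  by move=> /hpw /(le_trans (normr_Re_le _)); rewrite ReD ReN.
have q0 w : normc w = rho -> 0 <= Re q.[w].
  move=> wr; rewrite qE ReD /=.
  have wz : normc (w + z0 - z0) <= rho by rewrite addrK wr.
  by have := h0 _ wz; have := hRe _ wz; rewrite ler_norml => /andP[? ?] ?; lra.
have := poly_borel_caratheodory q0 zrho; rewrite !qE -/t -/K subrK add0r.
have -> : p.[z] + e'%:C - (p.[z0] + e'%:C) = p.[z] - p.[z0] by ring.
rewrite ReD /= => pz.
have z00 : normc (z0 - z0) <= rho by rewrite subrr normc0; lra.
have := hpw _ z00; have := hpw z (ltW zrho); have := hRe _ z00.
rewrite ler_norml => /andP[r1 r2] hz hz0.
have -> : h z - h z0 = (h z - p.[z]) + ((p.[z] - p.[z0]) - (h z0 - p.[z0])) by ring.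
rewrite (le_trans (le_normcD _ _))//.
have := le_normcB (p.[z] - p.[z0]) (h z0 - p.[z0]) => h5.
have h6 : 2 * (Re p.[z0] + e') * K <= 2 * (Re (h z0) + 2 * e') * K.
  by rewrite ler_wpM2r//; lra.
have h7 : e = 2 * e' + 4 * e' * K by rewrite /e'; field; rewrite gt_eqF.
by lra.
Qed.

Lemma poly_bounded p (B : R) : exists M : R, forall z, normc z <= B -> normc p.[z] <= M.
Proof.
elim/poly_ind : p => [|p c [M hM]].
  by exists 0 => z _; rewrite horner0 normc0.
exists (`|M| * `|B| + normc c) => z zB; rewrite hornerMXaddC.
rewrite (le_trans (le_normcD _ _))// lerD2r normcM ler_pM ?normc_ge0//.
  by rewrite (le_trans (hM _ zB))// ler_norm.
by rewrite (le_trans zB)// ler_norm.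
Qed.

Lemma poly_lipschitz p (B : R) : exists2 L : R, 0 <= L &
  forall z w, normc z <= B -> normc w <= B -> normc (p.[z] - p.[w]) <= L * normc (z - w).
Proof.
elim/poly_ind : p => [|p c [L L0 hL]].
  by exists 0 => // z w _ _; rewrite !horner0 subrr normc0 mul0r.
have [M hM] := poly_bounded p B.
exists (L * `|B| + `|M|) => [|z w zB wB].
  by rewrite addr_ge0// mulr_ge0.
rewrite !hornerMXaddC.
have -> : p.[z] * z + c - (p.[w] * w + c) = (p.[z] - p.[w]) * z + p.[w] * (z - w) by ring.
rewrite (le_trans (le_normcD _ _))// !normcM mulrDl lerD//.
  rewrite mulrAC ler_pM ?normc_ge0 ?hL//.
  by rewrite (le_trans zB)// ler_norm.
by rewrite ler_wpM2r ?normc_ge0// (le_trans (hM _ wB))// ler_norm.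
Qed.

Lemma approximable_poly p : approximable (fun z => p.[z]).
Proof. by move=> B e /ltW e0; exists p => z _; rewrite subrr normc0. Qed.

Lemma approximable_add h1 h2 : approximable h1 -> approximable h2 ->
  approximable (fun z => h1 z + h2 z).
Proof.
move=> a1 a2 B e e0; have e2 : 0 < e / 2 by lra.
have [p1 hp1] := a1 B _ e2; have [p2 hp2] := a2 B _ e2.
exists (p1 + p2) => z zB; rewrite hornerD opprD addrACA (le_trans (le_normcD _ _))//.
by have := hp1 _ zB; have := hp2 _ zB; lra.
Qed.

Lemma approximable_comp h1 h2 : approximable h1 -> approximable h2 ->
  approximable (fun z => h1 (h2 z)).
Proof.
move=> a1 a2 B e e0; have e2 : 0 < e / 2 by lra.
have [q hq] := a2 B 1 ltr01; have [M hM] := poly_bounded q B.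
have [p1 hp1] := a1 (M + 2) _ e2.
have [L L0 hL] := poly_lipschitz p1 (M + 2).
have d0 : 0 < Num.min 1 (e / 2 / (L + 1)).
  by rewrite lt_min ltr01/= divr_gt0//; lra.
have [p2 hp2] := a2 B _ d0.
exists (p1 \Po p2) => z zB; rewrite horner_comp.
have h2M : normc (h2 z) <= M + 1.
  have := le_normcD (h2 z - q.[z]) q.[z]; rewrite subrK => /le_trans; apply.
  by have := hq _ zB; have := hM _ zB; lra.
have := hp2 _ zB; rewrite le_min => /andP[c1 c2].
have p2M : normc p2.[z] <= M + 2.
  have := le_normcB (h2 z) (h2 z - p2.[z]); rewrite opprB addrC subrK => /le_trans; apply.
  by lra.
have h2M' : normc (h2 z) <= M + 2 by lra.
rewrite (le_trans (le_normc_tri _ p1.[h2 z] _))//.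
have := hp1 _ h2M'; have := hL _ _ h2M' p2M.
have : L * normc (h2 z - p2.[z]) <= e / 2.
  have L1 : 0 < L + 1 by lra.
  move: c2; rewrite ler_pdivlMr// mulrC; apply: le_trans.
  by rewrite ler_wpM2r ?normc_ge0//; lra.
by lra.
Qed.

Lemma approximable_iter h n : approximable h -> approximable (iter n h).
Proof.
move=> ha; elim: n => [|n IH]; last exact: approximable_comp ha IH.
move=> B e e0; have [p hp] := approximable_poly 'X B e0; exists p => z /hp.
by rewrite hornerX.
Qed.

Lemma approximable_cexp : approximable (@cexp R).
Proof.
move=> B e e0.
wlog B0 : B / 0 <= B.
  move=> H; case/orP : (le_total 0 B) => h; first exact: H.
  have [p hp] := H 0 (lexx _); exists p => z zB; apply: hp; exact: le_trans h.
(* Large enough for [B / M <= 1/2] and for the final error [3 B^2 e^B / M <= e]. *)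
pose M0 := Num.truncn (2 * B + 3 * B ^+ 2 * expR B / e).
pose M := M0.+1.
have M0' : (0 : R) < M%:R by rewrite ltr0n.
have MB : 2 * B + 3 * B ^+ 2 * expR B / e < M%:R.
  by apply: real_truncnS_gt; rewrite num_real.
have q0 : 0 <= 3 * B ^+ 2 * expR B / e.
  by rewrite divr_ge0 ?(ltW e0)// !mulr_ge0 ?sqr_ge0 ?expR_ge0.
exists ((1 + (M%:R^-1 : C)%:P * 'X) ^+ M) => z zB.
rewrite !hornerE.
set a := cexp (M%:R^-1 * z).
have -> : cexp z = a ^+ M.
  by rewrite -cexpM -[(_ * z) *+ M]mulr_natl mulrA mulfV ?mul1r// pnatr_eq0.
set b := 1 + M%:R^-1 * z.
have nw : normc (M%:R^-1 * z) = normc z / M%:R.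
  by rewrite normcM Normc.normcV normc_nat mulrC.
have wB : normc (M%:R^-1 * z) <= B / M%:R.
  by rewrite nw ler_pM2r ?invr_gt0.
have BM : B / M%:R <= 2^-1 by rewrite ler_pdivrMr//; lra.
have a1 : normc a <= expR (B / M%:R).
  rewrite normc_cexp ler_expR (le_trans _ wB)// (le_trans (ler_norm _))//.
  exact: normr_Re_le.
have b1 : normc b <= expR (B / M%:R).
  rewrite (le_trans (le_normcD _ _))// Normc.normc1.
  by rewrite (le_trans _ (expR_ge1Dx _))// lerD2l.
have ab : normc (a - b) <= 3 * (B / M%:R) ^+ 2.
  rewrite /a /b opprD addrA (le_trans (cexp_dist_le (le_trans wB BM)))//.
  by rewrite ler_pM2l// lerXn2r ?nnegrE ?normc_ge0 ?divr_ge0// ltW.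
have E0 := expR_gt0 (B / M%:R).
rewrite subrXX normcM.
have s1 : normc (\sum_(i < M) a ^+ (M.-1 - i) * b ^+ i) <= M%:R * expR B.
  rewrite (le_trans (normc_sum _ _ _))//.
  apply: (@le_trans _ _ (\sum_(i < M) expR B)); last first.
    by rewrite sumr_const card_ord -[leLHS]mulr_natl.
  apply: ler_sum => i _; rewrite normcM !normcX.
  apply: (@le_trans _ _ (expR (B / M%:R) ^+ (M.-1 - i) * expR (B / M%:R) ^+ i)).
    by rewrite ler_pM ?exprn_ge0 ?normc_ge0// lerXn2r ?nnegrE ?normc_ge0// ltW.
  rewrite -exprD subnK; last by rewrite -ltnS; exact: ltn_ord.
  rewrite -expRM_natl ler_expR mulrA ler_pdivrMr// mulrC ler_wpM2l//.
  by rewrite ler_nat leqnSn.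
rewrite (le_trans (ler_pM _ _ ab s1)) ?normc_ge0//.
have -> : 3 * (B / M%:R) ^+ 2 * (M%:R * expR B) = 3 * B ^+ 2 * expR B / M%:R.
  by field; rewrite pnatr_eq0.
rewrite ler_pdivrMr// [leRHS]mulrC -ler_pdivrMr//.
by rewrite (le_trans _ (ltW MB))// lerDr mulr_ge0.
Qed.

End BorelCaratheodoryBound.

(** * Topology of the plane and complex derivatives *)

Section PlaneTopology.
Context {R : realType}.
Local Notation C := (plane R).
Implicit Types (z w d : C) (h : C -> C).

Lemma nbhs_planeP z (P : set C) :
  nbhs z P <-> exists2 e : R, 0 < e & forall w, normc (w - z) < e -> P w.
Proof.
split => [/nbhs_ballP[e /= e0 eP]|[e e0 eP]].
  have [x xe] : exists x : R, e = x%:C.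
    by apply/complex_realP/gtr0_real.
  exists x; first by rewrite -ltcR -xe.
  by move=> w wx; apply: eP; rewrite -ball_normE/= plane_normE normcBC xe ltcR.
apply/nbhs_ballP; exists (e%:C) => /=; first by rewrite ltcR.
by move=> w; rewrite -ball_normE/= plane_normE normcBC ltcR => /eP.
Qed.

Lemma plane_openP (U : set C) : open U <->
  forall z, U z -> exists2 e : R, 0 < e & forall w, normc (w - z) < e -> U w.
Proof.
rewrite openE; split => H z /H; first by move/nbhs_planeP.
by move=> Hz; apply/nbhs_planeP.
Qed.

(** The quadratic error term makes the chain rule an elementary computation, and every
    iterate of the map has such an expansion. *)
Definition cderiv h z d := exists K e : R, [/\ 0 <= K, 0 < e &
  forall w, normc w < e -> normc (h (z + w) - h z - d * w) <= K * normc w ^+ 2].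

Lemma cderiv_id z : cderiv id z 1.
Proof.
exists 0, 1; split => // w _.
by rewrite mul1r mul0r (_ : _ - _ - _ = 0) ?normc0//; ring.
Qed.

Lemma cderiv_lip h z d : cderiv h z d -> exists L e : R, [/\ 0 <= L, 0 < e &
  forall w, normc w < e -> normc (h (z + w) - h z) <= L * normc w].
Proof.
move=> [K [e [K0 e0 H]]]; exists (normc d + K * e), e; split => //.
  by rewrite addr_ge0 ?normc_ge0// mulr_ge0// ltW.
move=> w we; have := le_normcD (h (z + w) - h z - d * w) (d * w).
rewrite subrK normcM => /le_trans; apply.
have := H _ we => Hw; have w0 := normc_ge0 w.
have : K * normc w ^+ 2 <= K * e * normc w.
  by rewrite -mulrA ler_wpM2l// expr2 ler_wpM2r// ltW.
by rewrite mulrDl; lra.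
Qed.

Lemma cderiv_comp h1 h2 z d1 d2 : cderiv h1 (h2 z) d1 -> cderiv h2 z d2 ->
  cderiv (fun z => h1 (h2 z)) z (d1 * d2).
Proof.
move=> [K1 [e1 [K10 e10 H1]]] D2; have [L [e3 [L0 e30 H3]]] := cderiv_lip D2.
have [K2 [e2 [K20 e20 H2]]] := D2.
have L1 : 0 < L + 1 by lra.
exists (K1 * L ^+ 2 + normc d1 * K2), (Num.min (Num.min e2 e3) (e1 / (L + 1))); split.
- by rewrite addr_ge0// mulr_ge0 ?normc_ge0// sqr_ge0.
- by rewrite !lt_min e20 e30 divr_gt0.
move=> w; rewrite !lt_min => /andP[/andP[we2 we3]].
rewrite ltr_pdivlMr// => we1; have w0 := normc_ge0 w.
set v := h2 (z + w) - h2 z.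
have vL : normc v <= L * normc w by exact: H3.
have ve1 : normc v < e1 by lra.
have -> : h1 (h2 (z + w)) - h1 (h2 z) - d1 * d2 * w =
  (h1 (h2 z + v) - h1 (h2 z) - d1 * v) + d1 * (v - d2 * w).
  by rewrite {1}/v addrCA subrr addr0; ring.
rewrite (le_trans (le_normcD _ _))// normcM mulrDl -!mulrA lerD//.
  rewrite (le_trans (H1 _ ve1))// ler_wpM2l// mulrA -expr2 -exprMn.
  by rewrite lerXn2r ?nnegrE ?mulr_ge0 ?normc_ge0.
by rewrite ler_wpM2l ?normc_ge0// H2.
Qed.

Lemma cderiv_eps h z d : cderiv h z d -> forall e : R, 0 < e ->
  exists2 e' : R, 0 < e' & forall w, normc (w - z) < e' -> normc (h w - h z) < e.
Proof.
move=> /cderiv_lip[L [e1 [L0 e10 H]]] e e0; have L1 : 0 < L + 1 by lra.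
exists (Num.min e1 (e / (L + 1))); first by rewrite lt_min e10 divr_gt0.
move=> w; rewrite lt_min ltr_pdivlMr// => /andP[w1 w2].
have := H _ w1; rewrite (addrC z) subrK; have := normc_ge0 (w - z) => w0 /le_lt_trans; apply.
by have [->|/eqP wz] := eqVneq (normc (w - z)) 0; lra.
Qed.

Lemma cderiv_continuous h : (forall z, exists d, cderiv h z d) -> continuous h.
Proof.
move=> H z P /nbhs_planeP[e e0 eP]; have [d D] := H z.
have [e' e'0 H'] := cderiv_eps D e0.
by apply/nbhs_planeP; exists e' => // w /H' /eP.
Qed.

Lemma cderiv_is_derive h z d : cderiv h z d -> is_derive z (1 : C) h d.
Proof.
move=> [K [e [K0 e0 H]]].
have cv : (t^-1 *: (h (t *: 1 + z) - h z)) @[t --> (0 : C)^'] --> d.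
  move=> P /nbhs_planeP[e1 e10 eP].
  have K1 : 0 < K + 1 by lra.
  apply/nbhs_planeP; exists (Num.min e (e1 / (K + 1))).
    by rewrite lt_min e0 divr_gt0.
  move=> t; rewrite subr0 lt_min ltr_pdivlMr// => /andP[te te1] t0.
  apply: eP; rewrite /GRing.scale/= mulr1 (addrC t).
  have nt : normc t != 0.
    by apply: contra t0 => /eqP /normc_eq0 ->.
  have nt0 : 0 < normc t by rewrite lt_neqAle eq_sym nt normc_ge0.
  have -> : t^-1 * (h (z + t) - h z) - d = t^-1 * (h (z + t) - h z - d * t).
    by rewrite [RHS]mulrBr (mulrCA t^-1 d t) mulVf// mulr1.
  rewrite normcM Normc.normcV mulrC ltr_pdivrMr//.
  rewrite (le_lt_trans (H _ te))// expr2 mulrA ltr_pM2r//.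
  by lra.
have D : derivable h z 1 by apply/cvg_ex; exists d.
exact: (DeriveDef D (cvg_lim (@norm_hausdorff _ _) cv)).
Qed.

Lemma continuous_segment z w : continuous (fun t : R => z + t%:C * w : C).
Proof.
move=> t P /nbhs_planeP[e e0 eP].
have w1 : 0 < normc w + 1 by have := normc_ge0 w; lra.
apply/nbhs_ballP; exists (e / (normc w + 1)); first by rewrite /= divr_gt0.
move=> t'; rewrite /ball/= ltr_pdivlMr// => tt; apply: eP.
have -> : z + t'%:C * w - (z + t%:C * w) = (t' - t)%:C * w by rewrite rmorphB/=; ring.
rewrite normcM normc_real distrC; apply: le_lt_trans tt.
by rewrite ler_wpM2l// lerDl.
Qed.

End PlaneTopology.

(** * The fixed points of the map and their basins *)

Section Periodicity.
Context {R : realType}.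
Implicit Types (y : R) (k : int).

Lemma cosDsinD_2pin y n :
  (cos (y + n%:R * (2 * pi)) = cos y) * (sin (y + n%:R * (2 * pi)) = sin y).
Proof.
elim: n => [|n IH]; first by rewrite mul0r addr0.
have -> : y + n.+1%:R * (2 * pi) = y + n%:R * (2 * pi) + pi + pi.
  by rewrite -natr1; ring.
by rewrite !cosDpi !sinDpi !opprK !IH.
Qed.

Lemma cosDsinD_2pi y k :
  (cos (y + k%:~R * (2 * pi)) = cos y) * (sin (y + k%:~R * (2 * pi)) = sin y).
Proof.
case: k => n; first exact: cosDsinD_2pin.
rewrite NegzE mulrNz mulNr.
have := cosDsinD_2pin (y - n.+1%:~R * (2 * pi)) n.+1.
by rewrite subrK => -[-> ->].
Qed.

End Periodicity.

Section FixedPoints.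
Context {R : realType}.
Local Notation C := (plane R).
Implicit Types (z w : C) (k j : int).

Definition fixpt k : C := 0 +i* ((2 * k%:~R + 1) * pi).

Lemma cexp_fixpt k : cexp (fixpt k) = -1.
Proof.
have e : (2 * k%:~R + 1) * pi = pi + k%:~R * (2 * pi) :> R by ring.
apply: plane_eqP; rewrite /= e expR0 mul1r cosDsinD_2pi ?cospi ?sinpi ?oppr0//.
Qed.

Definition twopii k : C := 0 +i* (k%:~R * (2 * pi)).

Lemma cexpD_2pii z k : cexp (z + twopii k) = cexp z.
Proof.
by apply: plane_eqP; rewrite /= ReD ImD /= addr0 cosDsinD_2pi.
Qed.

Lemma fixptD k j : fixpt k + twopii j = fixpt (k + j).
Proof. by apply: plane_eqP; rewrite ?ReD ?ImD /= ?addr0// rmorphD/=; ring. Qed.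

(** The true distance is at least [2 pi]; 4 leaves room for the radii used below. *)
Lemma fixpt_dist k j : k != j -> 4 <= normc (fixpt k - fixpt j).
Proof.
move=> kj; apply: le_trans (normr_Im_le _).
rewrite ImD ImN /= -mulrBl.
have -> : 2 * k%:~R + 1 - (2 * j%:~R + 1) = 2 * (k - j)%:~R :> R.
  by rewrite rmorphB/=; ring.
have pi2 := pi_ge2 R.
have kj1 : 1 <= `|(k - j)%:~R : R|.
  by rewrite -intr_norm ler1z; rewrite -subr_eq0 in kj; lia.
rewrite !normrM normr_nat (gtr0_norm (pi_gt0 _)); nra.
Qed.

End FixedPoints.

Section Attractors.
Context {R : realType} (lambda : R).
Hypotheses (lambda_gt0 : 0 < lambda) (lambda_lt2 : lambda < 2).
Local Notation C := (plane R).
Local Notation f := (@f_ R lambda).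
Implicit Types (z w : C) (k j : int) (n m : nat).

Lemma f_fixpt k : f (fixpt k) = fixpt k.
Proof. by rewrite /f_ cexp_fixpt mulrN mulr1 addrAC addNr add0r. Qed.

Lemma fD_2pii z k : f (z + twopii k) = f z + twopii k.
Proof. by rewrite /f_ cexpD_2pii; ring. Qed.

Lemma iterD_2pii n z k : iter n f (z + twopii k) = iter n f z + twopii k.
Proof. by elim: n => //= n ->; rewrite fD_2pii. Qed.

Lemma f_dist z w : f (z + w) - f z - (1 + lambda%:C * cexp z) * w =
  lambda%:C * cexp z * (cexp w - 1 - w).
Proof. by rewrite /f_ cexpD; ring. Qed.

Lemma cderiv_f z : cderiv f z (1 + lambda%:C * cexp z).
Proof.
exists (lambda * expR (Re z) * 3), 2^-1; split => //.
- by rewrite !mulr_ge0 ?expR_ge0// ltW.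
move=> w w2; rewrite f_dist !normcM normc_real normc_cexp gtr0_norm//.
rewrite -[leRHS]mulrA ler_wpM2l ?mulr_ge0 ?expR_ge0 ?(ltW lambda_gt0)//.
by rewrite cexp_dist_le// ltW.
Qed.

(** The derivative of the [n]-th iterate, as the product given by the chain rule. *)
Fixpoint dprod n z : C :=
  if n is n'.+1 then (1 + lambda%:C * cexp (iter n' f z)) * dprod n' z else 1.

Lemma cderiv_iter n z : cderiv (iter n f) z (dprod n z).
Proof.
elim: n => [|n IH]; first exact: cderiv_id.
exact: cderiv_comp (cderiv_f _) IH.
Qed.

Lemma continuous_iter n : continuous (iter n f).
Proof. by apply: cderiv_continuous => z; exists (dprod n z); exact: cderiv_iter. Qed.

(** Distance from the modulus of the multiplier to 1. *)
Definition gap : R := 1 - `|1 - lambda|.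
(** On this disc around a fixed point the quadratic error of the linearization costs at
    most half of [gap], so [f] contracts by the factor [rate]. *)
Definition radius : R := gap / 12.
Definition rate : R := 1 - gap / 2.

Lemma gap_gt0 : 0 < gap.
Proof. have l2 := lambda_lt2; have l0 := lambda_gt0.
by rewrite subr_gt0 ltr_norml; apply/andP; split; lra. Qed.

Lemma gap_le1 : gap <= 1.
Proof. by rewrite lerBlDr lerDl. Qed.

Lemma radius_gt0 : 0 < radius.
Proof. by rewrite divr_gt0// gap_gt0. Qed.

Lemma rate_ge0 : 0 <= rate.
Proof. by have := gap_le1; rewrite /rate; lra. Qed.

Lemma rate_lt1 : rate < 1.
Proof. by have := gap_gt0; rewrite /rate; lra. Qed.

Lemma f_contract k z : normc (z - fixpt k) < radius ->
  normc (f z - fixpt k) <= rate * normc (z - fixpt k).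
Proof.
set w := z - fixpt k => wr; have -> : z = fixpt k + w by rewrite addrC subrK.
have := f_dist (fixpt k) w; rewrite cexp_fixpt f_fixpt !mulrN !mulr1 => E.
have -> : f (fixpt k + w) - fixpt k = (1 - lambda)%:C * w - lambda%:C * (cexp w - 1 - w).
  by rewrite -mulNr -E rmorphB/= rmorph1; ring.
have w0 := normc_ge0 w; have g1 := gap_le1; have g0 := gap_gt0.
rewrite (le_trans (le_normcB _ _))// !normcM !normc_real (gtr0_norm lambda_gt0).
have w2 : normc w <= 2^-1 by move: wr; rewrite /radius; lra.
have h1 := cexp_dist_le w2.
have h2 : lambda * normc (cexp w - 1 - w) <= 2 * (3 * normc w ^+ 2).
  by rewrite ler_pM ?normc_ge0// ltW.
have h3 : normc w ^+ 2 <= radius * normc w by rewrite expr2 ler_wpM2r// ltW.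
move: h3; rewrite /radius /rate.
have -> : `|1 - lambda| = 1 - gap by rewrite /gap; ring.
by rewrite !mulrBl; lra.
Qed.

Lemma iter_contract k z n : normc (z - fixpt k) < radius ->
  normc (iter n f z - fixpt k) <= rate ^+ n * normc (z - fixpt k) /\
  normc (iter n f z - fixpt k) < radius.
Proof.
move=> zr; elim: n => [|n [IH1 IH2]]; first by rewrite expr0 mul1r.
have h := f_contract IH2; split.
  by rewrite /= (le_trans h)// exprS -mulrA ler_wpM2l// rate_ge0.
rewrite /= (le_lt_trans h)// (le_lt_trans _ IH2)// ler_piMl ?normc_ge0//.
by rewrite ltW// rate_lt1.
Qed.

(** Reaching the disc of contraction is equivalent to converging to the fixed point, and
    makes openness immediate. *)
Definition basin k : set C := [set z | exists n, normc (iter n f z - fixpt k) < radius].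
Definition basins : set C := [set z | exists k, basin k z].

Lemma basin_near k z : basin k z -> exists n, forall m, (n <= m)%N ->
  normc (iter m f z - fixpt k) <= rate ^+ (m - n) * radius /\
  normc (iter m f z - fixpt k) < radius.
Proof.
move=> [n zn]; exists n => m nm.
have [h1 h2] := iter_contract (m - n) zn.
rewrite -[in iter m](subnK nm) iterD; split => //.
by rewrite (le_trans h1)// ler_wpM2l ?exprn_ge0 ?rate_ge0// ltW.
Qed.

Lemma rate_cvg (e : R) : 0 < e -> exists N, forall n, (N <= n)%N -> rate ^+ n * radius < e.
Proof.
move=> e0; have : (rate ^+ n * radius) @[n --> \oo] --> 0 * radius.
  apply: cvgMl; apply: cvg_expr.
  by rewrite ger0_norm ?rate_ge0// rate_lt1.
rewrite mul0r => /cvgrPdist_lt /(_ _ e0) [N _ H]; exists N => n Nn.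
have := H n Nn; rewrite /= sub0r normrN; apply: le_lt_trans; exact: ler_norm.
Qed.

Lemma basin_cvg k z : basin k z -> forall e : R, 0 < e ->
  exists N, forall n, (N <= n)%N -> normc (iter n f z - fixpt k) < e.
Proof.
move=> /basin_near[n0 H] e /rate_cvg[N HN].
exists (N + n0)%N => n Nn; have n0n : (n0 <= n)%N by lia.
by have [h _] := H n n0n; rewrite (le_lt_trans h)// HN//; lia.
Qed.

Lemma basin_open k : open (basin k).
Proof.
apply/plane_openP => z [n zn].
have e0 : 0 < radius - normc (iter n f z - fixpt k) by rewrite subr_gt0.
have [e' e'0 H] := cderiv_eps (cderiv_iter n z) e0.
exists e' => // w /H wz; exists n.
by rewrite (le_lt_trans (le_normc_tri _ (iter n f z) _))//; lra.
Qed.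

Lemma basins_open : open basins.
Proof.
have -> : basins = \bigcup_(k in setT) basin k.
  by apply/seteqP; split => z [k]; [exists k|exists k].
by apply: bigcup_open => k _; exact: basin_open.
Qed.

Lemma basin_disjoint k j z : basin k z -> basin j z -> k = j.
Proof.
move=> /basin_near[n Hn] /basin_near[m Hm]; apply/eqP; apply: contraT => kj.
have [_ h1] := Hn _ (leq_maxl n m); have [_ h2] := Hm _ (leq_maxr n m).
have := @fixpt_dist R _ _ kj; have := le_normc_tri (fixpt k) (iter (maxn n m) f z) (fixpt j).
rewrite (normcBC (fixpt k) (iter _ _ _)); move: h1 h2; rewrite /radius; have := gap_le1; lra.
Qed.

Lemma basin_iter k n z : basin k (iter n f z) <-> basin k z.
Proof.
split=> [[m]|].
  by rewrite -iterD => h; exists (m + n)%N.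
move=> /basin_near[m Hm]; exists m; rewrite -iterD.
by have [] := Hm (m + n)%N (leq_addr _ _).
Qed.

Lemma basins_iter n z : basins (iter n f z) <-> basins z.
Proof. by split=> -[k kz]; exists k; move: kz; rewrite basin_iter. Qed.

Lemma basinsD_2pii z k : basins z -> basins (z + twopii k).
Proof.
move=> [j [n jz]]; exists (j + k), n; rewrite iterD_2pii -fixptD.
by rewrite opprD addrACA subrr addr0.
Qed.

Lemma basin_fixpt k : basin k (fixpt k).
Proof. by exists 0%N; rewrite [iter _ _ _]/= subrr normc0 radius_gt0. Qed.

End Attractors.

(** * The invariant lines: the Ricker map *)

Section Ricker.
Context {R : realType} (lambda : R).
Hypotheses (lambda_gt0 : 0 < lambda) (lambda_lt2 : lambda < 2).
Implicit Types u t x a : R.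

(** For [t < 1], the exponential [e^(2t)] stays below its Pade approximant [(1 + t) / (1 - t)]. *)
Lemma pade_expR t : 0 < t -> (1 - t) * expR t < (1 + t) * expR (- t).
Proof.
move=> t0.
pose g t : R := (1 + t) * expR (- t) - (1 - t) * expR t.
pose dg t : R := t * (expR t - expR (- t)).
have dgE x : is_derive x 1 g (dg x).
  rewrite /g /dg; apply: is_derive_eq.
  by rewrite /GRing.scale /=; ring.
have gc : {within `[0, t], continuous g}.
  apply: continuous_subspaceT => x; apply: differentiable_continuous.
  by apply/derivable1_diffP; case: (dgE x).
have [c] := MVT t0 (fun x _ => dgE x) gc.
rewrite in_itv/= => /andP[c0 ct].
have -> : g 0 = 0 by rewrite /g oppr0 expR0; ring.
rewrite !subr0 => E.
by rewrite -subr_gt0 -/(g t) E !mulr_gt0// subr_gt0 ltr_expR; lra.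
Qed.

Definition ricker u : R := u * expR (lambda * (1 - u)).

(** The graph of the Ricker map lies between the diagonal and the line [2 - u], that is,
    between [u] and its reflection in the fixed point 1.  For [lambda = 2] the second
    bound is [pade_expR], and a smaller [lambda] only helps. *)
Lemma ricker_lt u : 0 < u -> u != 1 -> `|ricker u - 1| < `|u - 1|.
Proof.
move=> u0 u1; have l0 := lambda_gt0; have l2 := lambda_lt2.
have [ult|ugt|/eqP] := ltgtP u 1; last by rewrite (negbTE u1).
  rewrite (ltr0_norm (_ : u - 1 < 0)) ?subr_lt0// ltr_norml.
  have t0 : 0 < 1 - u by lra.
  have h1 : 1 < expR (lambda * (1 - u)).
    by rewrite -[ltLHS]expR0 ltr_expR mulr_gt0.
  have h2 : expR (lambda * (1 - u)) <= expR (1 - u) * expR (1 - u).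
    by rewrite -expRD ler_expR; nra.
  have := pade_expR t0.
  have -> : 1 - (1 - u) = u by ring.
  rewrite -(ltr_pM2r (expR_gt0 (1 - u))) -[ltRHS]mulrA -expRD addNr expR0 mulr1 => h3.
  have h4 : ricker u <= u * expR (1 - u) * expR (1 - u).
    by rewrite -mulrA ler_pM2l.
  have h5 : u < ricker u by rewrite ltr_pMr.
  by apply/andP; split; lra.
rewrite (gtr0_norm (_ : 0 < u - 1)) ?subr_gt0// ltr_norml.
have t0 : 0 < u - 1 by lra.
have h1 : expR (lambda * (1 - u)) < 1.
  by rewrite -[ltRHS]expR0 ltr_expR; nra.
have h2 : expR (- (u - 1)) * expR (- (u - 1)) <= expR (lambda * (1 - u)).
  by rewrite -expRD ler_expR; nra.
have := pade_expR t0.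
have -> : 1 + (u - 1) = u by ring.
rewrite -(ltr_pM2r (expR_gt0 (- (u - 1)))) -[ltLHS]mulrA -expRD subrr expR0 mulr1 => h3.
have h4 : u * expR (- (u - 1)) * expR (- (u - 1)) <= ricker u.
  by rewrite -mulrA ler_pM2l.
have h5 : ricker u < u by rewrite gtr_pMr.
by apply/andP; split; lra.
Qed.

Lemma ricker_gt0 u : 0 < u -> 0 < ricker u.
Proof. by move=> u0; rewrite mulr_gt0// expR_gt0. Qed.

Lemma continuous_ricker_gain : continuous (fun u => `|ricker u - 1| - `|u - 1|).
Proof.
have c1 : continuous (fun u : R => u - 1).
  by move=> u; apply: cvgB; [exact: cvg_id|exact: cvg_cst].
have c2 : continuous ricker.
  move=> u; apply: cvgM; first exact: cvg_id.
  apply: (@continuous_comp _ _ _ (fun u => lambda * (1 - u)) (@expR R)).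
    apply: cvgM; first exact: cvg_cst.
    by apply: cvgB; [exact: cvg_cst|exact: cvg_id].
  exact: continuous_expR.
move=> u; apply: cvgB; apply: cvg_norm; last exact: c1.
by apply: cvgB; [exact: c2|exact: cvg_cst].
Qed.

Lemma neg_continuous_bound (g : R -> R) (a b : R) : continuous g ->
  (forall u, a <= u <= b -> g u < 0) ->
  exists2 e : R, 0 < e & forall u, a <= u <= b -> g u <= - e.
Proof.
move=> gc g0; have [ab|ba] := leP a b; last first.
  by exists 1 => // u /andP[au ub]; have := le_lt_trans (le_trans au ub) ba; rewrite ltxx.
have [c] := EVT_max ab (continuous_subspaceT gc).
rewrite in_itv/= => cab cmax; exists (- g c); first by rewrite oppr_gt0 g0.
by move=> u uab; rewrite opprK cmax// in_itv.
Qed.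

(** The orbit first enters [u < 2], where the distance [d] to 1 is below 1 and
    the orbit stays away from 0.  While it also stays away from 1, each step gains
    a fixed amount, by compactness. *)
Lemma ricker_cvg u a : 0 < u -> 0 < a -> exists n, `|iter n ricker u - 1| < a.
Proof.
move=> u0 a0; apply: contrapT => /forallNP H.
pose v n := iter n ricker u.
have va n : a <= `|v n - 1| by rewrite leNgt; apply/negP; exact: H.
have v0 n : 0 < v n by elim: n => // n; exact: ricker_gt0.
have v1 n : v n != 1.
  by apply: contraTN (va n) => /eqP ->; rewrite subrr normr0 -ltNge.
have vd n : `|v n.+1 - 1| < `|v n - 1| by exact: ricker_lt.
have [n0 vn0] : exists n0, v n0 < 2.
  apply: contrapT => /forallNP H2.
  have vq n : v n <= expR (- lambda) ^+ n * u.
    elim: n => [|n IH]; first by rewrite expr0 mul1r.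
    have v2 : 2 <= v n by rewrite leNgt; apply/negP; exact: H2.
    rewrite exprS -mulrA [v n.+1]/(v n * expR (lambda * (1 - v n))) mulrC.
    rewrite ler_pM ?expR_ge0 ?(ltW (v0 n))// ler_expR.
    by rewrite -[leRHS]mulrN1 ler_pM2l//; lra.
  have : (expR (- lambda) ^+ n * u) @[n --> \oo] --> 0 * u.
    apply: cvgMl; apply: cvg_expr.
    by rewrite ger0_norm ?expR_ge0// -expR0 ltr_expR oppr_lt0.
  rewrite mul0r => /cvgrPdist_lt /(_ 2 (ltr0n _ _)) [N _ HN].
  have := HN N (leqnn _); rewrite /= sub0r normrN => /(le_lt_trans (ler_norm _)).
  by move=> /(le_lt_trans (vq N)); exact: H2.
set d := `|v n0 - 1|.
have d1 : d < 1 by rewrite ltr_norml; have := v0 n0 => ?; apply/andP; split; lra.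
have neg x : 0 < x -> x != 1 -> `|ricker x - 1| - `|x - 1| < 0.
  by move=> x0 x1; rewrite subr_lt0; exact: ricker_lt.
have [|e1 e10 He1] := @neg_continuous_bound _ (1 - d) (1 - a) continuous_ricker_gain.
  by move=> x /andP[x1 x2]; apply: neg; [lra|rewrite lt_eqF//; lra].
have [|e2 e20 He2] := @neg_continuous_bound _ (1 + a) (1 + d) continuous_ricker_gain.
  by move=> x /andP[x1 x2]; apply: neg; [lra|rewrite gt_eqF//; lra].
pose e := Num.min e1 e2; have e0 : 0 < e by rewrite lt_min e10.
have vb n : `|v (n + n0)%N - 1| <= d - n%:R * e.
  elim: n => [|n IH]; first by rewrite mul0r subr0.
  have vnd : `|v (n + n0)%N - 1| <= d.
    by rewrite (le_trans IH)// lerBlDr lerDl mulr_ge0// ltW.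
  have : `|v (n + n0).+1%N - 1| - `|v (n + n0)%N - 1| <= - e.
    have := va (n + n0)%N; move: vnd; rewrite ler_norml => /andP[b1 b2].
    rewrite ler_normr => /orP[b3|b3].
      apply: le_trans (He2 (v (n + n0)%N) _) _; last by rewrite lerN2 ge_min lexx orbT.
      by apply/andP; split; lra.
    apply: le_trans (He1 (v (n + n0)%N) _) _; last by rewrite lerN2 ge_min lexx.
    by apply/andP; split; lra.
  by rewrite addSn -natr1 mulrDl mul1r; lra.
have := vb (Num.truncn (d / e)).+1.
have : d / e < (Num.truncn (d / e)).+1%:R by apply: real_truncnS_gt; rewrite num_real.
rewrite ltr_pdivrMr// => h1 h2.
have := le_trans (normr_ge0 _) h2; lra.
Qed.

Local Notation f := (@f_ R lambda).

Lemma f_line x (y : R) : cos y = -1 -> sin y = 0 ->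
  f (x +i* y : plane R) = (x + lambda * (1 - expR x)) +i* y.
Proof.
by move=> c s; apply: plane_eqP; rewrite /f_ !(ReD, ImD, ReM, ImM) /= c s; ring.
Qed.

(** On this line [cexp z] is the negative real [- e^x], so the line is
    invariant and [e^x] moves by [ricker]. *)
Lemma line_basins (z : plane R) k : Im z = (2 * k%:~R + 1) * pi -> basins lambda z.
Proof.
case: z => x y /= ->; exists k.
pose r := radius lambda; have r0 : 0 < r by exact: radius_gt0.
have [cs sn] : cos ((2 * k%:~R + 1) * pi : R) = -1 /\ sin ((2 * k%:~R + 1) * pi : R) = 0.
  have := cexp_fixpt (R := R) k => -[]; rewrite expR0 !mul1r => -> ->.
  by rewrite oppr0.
pose T t : R := t + lambda * (1 - expR t).
have iterT n : iter n f ((x +i* ((2 * k%:~R + 1) * pi)) : plane R) =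
    (iter n T x) +i* ((2 * k%:~R + 1) * pi).
  by elim: n => //= n ->; rewrite f_line.
have iterR n : expR (iter n T x) = iter n ricker (expR x).
  by elim: n => //= n <-; rewrite /T expRD.
have a0 : 0 < 1 - expR (- r) by rewrite subr_gt0 -expR0 ltr_expR oppr_lt0.
have [n] := ricker_cvg (expR_gt0 x) a0.
rewrite -iterR ltr_norml => /andP[h1 h2]; exists n; rewrite iterT.
set t := iter n T x in h1 h2 *.
have -> : (t +i* ((2 * k%:~R + 1) * pi) : plane R) - fixpt k = t%:C.
  by apply: plane_eqP; rewrite ?(ReD, ImD, ReN, ImN) /= ?subr0 ?subrr.
rewrite normc_real ltr_norml -/r -ltr_expR -[t < r]ltr_expR.
have := expR_ge1Dx r; have := expR_ge1Dx (- r).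
by move=> *; apply/andP; split; lra.
Qed.

End Ricker.

(** * Expansion in the horizontal strips *)

Section Expansion.
Context {R : realType} (lambda : R).
Hypotheses (lambda_gt0 : 0 < lambda) (lambda_lt2 : lambda < 2).
Local Notation C := (plane R).
Local Notation f := (@f_ R lambda).
Implicit Types (z w d : C) (k j : int) (n m : nat).

(** This is [cos^2 (Im z / 2)]: up to a factor, the inverse square of the hyperbolic
    density of the strip of width [2 pi] that contains [z]. *)
Definition cos2half z : R := (1 + cos (Im z)) / 2.
(** The modulus of [lambda e^z], both the displacement beyond the translation by [lambda]
    and the deviation of the derivative from 1. *)
Definition speed z : R := lambda * expR (Re z).

Lemma cos2half_ge0 z : 0 <= cos2half z.
Proof. by rewrite divr_ge0//; have := cos_geN1 (Im z); lra. Qed.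

Lemma cos2half_le1 z : cos2half z <= 1.
Proof. by rewrite /cos2half; have := cos_le1 (Im z); lra. Qed.

Lemma speed_gt0 z : 0 < speed z.
Proof. by rewrite mulr_gt0// expR_gt0. Qed.

Lemma Re_f z : Re (f z) = Re z + speed z * cos (Im z) + lambda.
Proof. by rewrite /f_ !(ReD, ReM) /= /speed; ring. Qed.

Lemma Im_f z : Im (f z) = Im z + speed z * sin (Im z).
Proof. by rewrite /f_ !(ImD, ImM) /= /speed; ring. Qed.

Lemma speed_f z : speed (f z) = speed z * expR (lambda + speed z * (2 * cos2half z - 1)).
Proof.
rewrite {1}/speed Re_f -addrA [in LHS]expRD mulrA -/(speed z); congr (_ * expR _).
by rewrite /cos2half; field.
Qed.

(** Divided by [cos2half (f z)], this says that the square of the hyperbolic derivative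
    exceeds 1 by at least [cos2half z ^ 2 * (2 s + s ^ 2)].  After expansion, the difference
    of the two sides is half the error in [cos_taylor2] at [y = Im z], [a = s sin y]. *)
Lemma f_expands z : cos2half (f z) + cos2half z ^+ 2 * (2 * speed z + speed z ^+ 2) <=
  cos2half z * normc (1 + lambda%:C * cexp z) ^+ 2.
Proof.
rewrite sqr_normc !(ReD, ImD, ReM, ImM) /= /cos2half Im_f.
set s := speed z; set y := Im z.
have := cos_taylor2 y (s * sin y) => h.
have -> : 1 + (lambda * (expR (Re z) * cos y) - 0 * (expR (Re z) * sin y)) =
   1 + s * cos y by rewrite /s /speed; ring.
have -> : 0 + (lambda * (expR (Re z) * sin y) + 0 * (expR (Re z) * cos y)) =
   s * sin y by rewrite /s /speed; ring.
have ss : sin y ^+ 2 = 1 - cos y ^+ 2 by exact: sin2cos2.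
rewrite -subr_ge0.
have -> : (1 + cos y) / 2 * ((1 + s * cos y) ^+ 2 + (s * sin y) ^+ 2) -
    ((1 + cos (y + s * sin y)) / 2 + ((1 + cos y) / 2) ^+ 2 * (2 * s + s ^+ 2)) =
    (cos y - s * sin y * sin y + (s * sin y) ^+ 2 / 2 - cos (y + s * sin y)) / 2.
  have -> : s * sin y * sin y = s * sin y ^+ 2 by ring.
  by rewrite !(exprMn _ s) ss; field.
by rewrite divr_ge0// subr_ge0.
Qed.

Lemma cos2half_eq0 z : cos2half z = 0 -> exists k, Im z = (2 * k%:~R + 1) * pi.
Proof.
move=> /eqP; rewrite mulf_eq0 invr_eq0 pnatr_eq0 orbF => /eqP c1.
have p0 := pi_gt0 R.
pose k := Num.floor (Im z / (2 * pi)); exists k.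
have /andP[k1 k2] := floor_itv (Im z / (2 * pi)); rewrite -/k in k1 k2.
have p2 : 0 < 2 * pi :> R by lra.
rewrite ler_pdivlMr// in k1; rewrite ltr_pdivrMr// rmorphD/= mulrDl mul1r in k2.
set t := Im z - k%:~R * (2 * pi) - pi.
have ct : cos `|t| = cos 0.
  have -> : cos `|t| = cos t by case: (ger0P t) => _; rewrite ?cosN.
  rewrite cos0 /t; apply/eqP; rewrite -eqr_opp -cosDpi subrK.
  have <- : cos (Im z) = cos (Im z - k%:~R * (2 * pi)).
    by have [<- _] := cosDsinD_2pi (Im z - k%:~R * (2 * pi)) k; rewrite subrK.
  by apply/eqP; lra.
have : `|t| = 0.
  apply: (@cos_inj R) => //; rewrite in_itv/= ?lexx ?(ltW p0)// normr_ge0/=.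
  by rewrite ler_norml /t; apply/andP; split; lra.
by move/normr0_eq0; rewrite /t => t0; lra.
Qed.

Lemma cos2half_gt0 z : ~ basins lambda z -> 0 < cos2half z.
Proof.
move=> zb; rewrite lt_neqAle cos2half_ge0 andbT eq_sym; apply/eqP => /cos2half_eq0[k zk].
by apply: zb; exact: line_basins zk.
Qed.

(** A bounded quantity cannot infinitely often grow by a definite factor. *)
Lemma growth_bounded (H a : nat -> R) (K : R) : 0 < H 0%N ->
  (forall n, 0 <= a n) -> (forall n, H n * (1 + a n) <= H n.+1) ->
  (forall n, H n <= K) ->
  forall e, 0 < e -> exists N, forall n, (N <= n)%N -> a n < e.
Proof.
move=> H0 a0 Ha HK e e0; apply: contrapT => /forallNP bad.
have Hm n m : H n <= H (n + m)%N /\ 0 < H n.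
  have Hp i : 0 < H i.
    by elim: i => // i IH; rewrite (lt_le_trans _ (Ha i))// mulr_gt0// ltr_wpDr.
  split => //; elim: m => [|m IH]; first by rewrite addn0.
  by rewrite addnS (le_trans IH)// (le_trans _ (Ha _))// ler_peMr ?(ltW (Hp _))// lerDl.
have big m : exists n, H 0%N * (1 + m%:R * e) <= H n.
  elim: m => [|m [n IH]]; first by exists 0%N; rewrite mul0r addr0 mulr1.
  have /existsNP[i /not_implyP[ni /negP]] := bad n; rewrite -leNgt => ai.
  exists i.+1; rewrite (le_trans _ (Ha i))// mulrDr mulr1 -natr1.
  have h1 : H 0%N * e <= H i * a i.
    rewrite ler_pM ?(ltW e0) ?(ltW H0)//.
    by have [] := Hm 0%N i; rewrite add0n.
  by have [] := Hm n (i - n)%N; rewrite subnKC//; lra.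
have [n] := big (Num.truncn (K / (H 0%N * e))).+1.
have := real_truncnS_gt (num_real (K / (H 0%N * e))).
rewrite ltr_pdivrMr ?mulr_gt0//; set T := _%:R => h1 h2.
by have := HK n; lra.
Qed.

Lemma continuous_complex : continuous (fun xy : R * R => (xy.1 +i* xy.2 : plane R)).
Proof.
move=> [x y] P /nbhs_planeP[e e0 eP].
have e2 : 0 < e / 2 by lra.
exists (ball x (e / 2), ball y (e / 2)) => /=; first by split; exact: nbhsx_ballx.
move=> [u v] [/= hu hv]; apply: eP; apply: le_lt_trans (normc_le_ReIm _) _.
rewrite !(ReD, ImD, ReN, ImN) /=; move: hu hv; rewrite /ball/= !(distrC _ u) !(distrC _ v).
lra.
Qed.

(** Translation by [2 pi i] reduces to a compact rectangle, and [cos2half] vanishes only on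
    the invariant lines, which lie in the basins. *)
Lemma cos2half_window (a b : R) : exists2 e : R, 0 < e &
  forall z, ~ basins lambda z -> a <= Re z <= b -> e <= cos2half z.
Proof.
pose N : set (R * R) := (`[a, b]%classic `*` `[0, 2 * pi]%classic) `&`
  [set xy | ~ basins lambda (xy.1 +i* xy.2)].
have red z : ~ basins lambda z -> a <= Re z <= b ->
    exists2 xy, N xy & cos2half z = (1 + cos xy.2) / 2.
  move=> zb zab; have p0 := pi_gt0 R.
  pose k := Num.floor (Im z / (2 * pi)).
  have /andP[k1 k2] := floor_itv (Im z / (2 * pi)); rewrite -/k in k1 k2.
  have p2 : 0 < 2 * pi :> R by lra.
  rewrite ler_pdivlMr// in k1; rewrite ltr_pdivrMr// rmorphD/= mulrDl mul1r in k2.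
  exists (Re z, Im z - k%:~R * (2 * pi)).
    split; first by split; rewrite /= in_itv//=; apply/andP; split; lra.
    move=> /= zk; apply: zb; have := basinsD_2pii k zk; congr basins.
    by apply: plane_eqP; rewrite ?(ReD, ImD)/= ?addr0 ?subrK.
  rewrite /cos2half /=; congr ((1 + _) / 2).
  by have [<- _] := cosDsinD_2pi (Im z - k%:~R * (2 * pi)) k; rewrite subrK.
have [N0|N0] := pselect (N !=set0); last first.
  by exists 1 => // z zb zab; have [xy Nxy] := red z zb zab; case: N0; exists xy.
have Nc : compact N.
  apply: compact_closedI; first by apply: compact_setX; exact: segment_compact.
  have -> : [set xy : R * R | ~ basins lambda (xy.1 +i* xy.2)] =
    (fun xy : R * R => (xy.1 +i* xy.2 : plane R)) @^-1` (~` basins lambda) by [].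
  move/continuous_closedP : continuous_complex; apply.
  by apply: open_closedC; exact: basins_open.
have cc : continuous (fun xy : R * R => (1 + cos xy.2) / 2).
  move=> xy; apply: cvgMl; apply: cvgD; first exact: cvg_cst.
  apply: (@continuous_comp _ _ _ snd (@cos R)); first exact: cvg_snd.
  exact: continuous_cos.
have [c /set_mem Nc0 cmin] := compact_EVT_min N0 Nc (continuous_subspaceT cc).
exists ((1 + cos c.2) / 2).
  by have [_ /cos2half_gt0] := Nc0.
by move=> z zb zab; have [xy /mem_set/cmin cxy ->] := red z zb zab.
Qed.

End Expansion.

(** * The basins are dense *)

Section Density.
Context {R : realType} (lambda : R).
Hypotheses (lambda_gt0 : 0 < lambda) (lambda_lt2 : lambda < 2).
Local Notation C := (plane R).
Local Notation f := (@f_ R lambda).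
Implicit Types (z w d : C) (k j : int) (n m : nat).

Lemma segment_IVT (F : C -> R) z w (v : R) :
  (forall u e, 0 < e -> exists2 e' : R, 0 < e' &
     forall u', normc (u' - u) < e' -> `|F u' - F u| < e) ->
  F z <= v <= F w -> exists2 t, 0 <= t <= 1 & F (z + t%:C * (w - z)) = v.
Proof.
move=> Fc /andP[zv vw].
pose phi t := F (z + t%:C * (w - z)).
have phic : continuous phi.
  move=> t; apply/cvgrPdist_lt => e e0.
  have [e' e'0 H] := Fc (z + t%:C * (w - z)) e e0.
  have nz : nbhs (z + t%:C * (w - z))
      [set u | normc (u - (z + t%:C * (w - z))) < e'] by apply/nbhs_planeP; exists e'.
  have nt : \forall t' \near t,
      normc (z + t'%:C * (w - z) - (z + t%:C * (w - z))) < e'.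
    exact: (@continuous_segment R z (w - z) t _ nz).
  by near=> t'; rewrite distrC; apply: H; near: t'; exact: nt.
have p0 : phi 0 = F z by rewrite /phi rmorph0 mul0r addr0.
have p1 : phi 1 = F w by rewrite /phi rmorph1 mul1r addrC subrK.
have [|t] := @IVT R phi 0 1 v ler01 (continuous_subspaceT phic).
  by rewrite p0 p1 ge_min le_max zv vw orbT.
by rewrite in_itv => t01 <-; exists t.
Unshelve. all: by end_near. Qed.

Lemma Im_iter_eps n u (e : R) : 0 < e -> exists2 e' : R, 0 < e' &
  forall u', normc (u' - u) < e' -> `|Im (iter n f u') - Im (iter n f u)| < e.
Proof.
move=> e0; have [e' e'0 H] := cderiv_eps (cderiv_iter lambda_gt0 n u) e0.
exists e' => // u' /H; apply: le_lt_trans.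
by rewrite -ImN -ImD; exact: normr_Im_le.
Qed.

Section EmptyInterior.
Variables (z0 : C) (r : R).
Hypotheses (r_gt0 : 0 < r).
Hypothesis escape : forall z, normc (z - z0) < r -> ~ basins lambda z.

Lemma escape_line n k z : normc (z - z0) < r ->
  Im (iter n f z) != (2 * k%:~R + 1) * pi.
Proof.
move=> zr; apply/eqP => /(line_basins lambda_gt0 lambda_lt2).
by move/(basins_iter lambda_gt0 lambda_lt2); exact: escape.
Qed.

(** The image of the disc is connected and avoids the invariant lines. *)
Lemma strip n : exists k, forall z, normc (z - z0) < r ->
  (2 * k%:~R - 1) * pi < Im (iter n f z) < (2 * k%:~R + 1) * pi.
Proof.
have p0 := pi_gt0 R; set y0 := Im (iter n f z0).
pose k := Num.floor ((y0 + pi) / (2 * pi)); exists k => z zr.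
have /andP[k1 k2] := floor_itv ((y0 + pi) / (2 * pi)); rewrite -/k in k1 k2.
have p2 : 0 < 2 * pi :> R by lra.
rewrite ler_pdivlMr// in k1; rewrite ltr_pdivrMr// rmorphD/= mulrDl mul1r in k2.
have seg w (t : R) : normc (w - z0) < r -> 0 <= t <= 1 ->
    normc (z0 + t%:C * (w - z0) - z0) < r.
  move=> wr /andP[t0 t1]; rewrite addrAC subrr add0r normcM normc_real ger0_norm//.
  by rewrite (le_lt_trans _ wr)// ler_piMl ?normc_ge0.
rewrite !ltNge -negb_or; apply/negP => /orP[h|h].
  have [||t t01 /eqP] := @segment_IVT (fun z => - Im (iter n f z)) z0 z (- ((2 * k%:~R - 1) * pi)).
  - move=> u e e0; have [e' e'0 H] := Im_iter_eps n u e0; exists e' => // u' /H.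
    by rewrite -opprD normrN.
  - by rewrite !lerN2 h andbT -/y0; lra.
  rewrite eqr_opp; apply/negP.
  have -> : (2 * k%:~R - 1) * pi = (2 * (k - 1)%:~R + 1) * pi :> R.
    by rewrite rmorphB/=; ring.
  exact/escape_line/seg.
have [||t t01 /eqP] := @segment_IVT (fun z => Im (iter n f z)) z0 z ((2 * k%:~R + 1) * pi).
- by move=> u e e0; exact: Im_iter_eps.
- by rewrite h andbT -/y0; lra.
by apply/negP/escape_line/seg.
Qed.

Lemma cderiv_bound (h : C -> C) z d (rho B : R) : 0 < rho -> 0 <= B ->
  cderiv h z d ->
  (forall w, normc w < rho -> normc (h (z + w) - h z) <= B * (normc w / (rho - normc w))) ->
  normc d <= 2 * B / rho.
Proof.
move=> rho0 B0 [K [e [K0 e0 He]]] HB; apply/ler_addgt0Pr => e1 e10.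
have K1 : 0 < K + 1 by lra.
pose t := Num.min (Num.min (e / 2) (rho / 2)) (e1 / (K + 1)).
have t0 : 0 < t by rewrite !lt_min !divr_gt0.
have te : t <= e / 2 by rewrite /t !ge_min lexx.
have tr : t <= rho / 2 by rewrite /t !ge_min lexx orbT.
have tk : K * t <= e1.
  have : t <= e1 / (K + 1) by rewrite /t !ge_min lexx orbT.
  rewrite ler_pdivlMr// mulrDr mulr1; rewrite mulrC; lra.
have nt : normc (t%:C : C) = t by rewrite normc_real gtr0_norm.
have h1 : normc (t%:C : C) < e by rewrite nt; lra.
have h2 : normc (t%:C : C) < rho by rewrite nt; lra.
have := He _ h1; have := HB _ h2; rewrite nt => a1 a2.
have a3 : B * (t / (rho - t)) <= B * (2 * t / rho).
  rewrite ler_wpM2l// ler_pdivrMr ?subr_gt0//; last by lra.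
  rewrite mulrAC ler_pdivlMr// [leRHS]mulrC; nra.
have := le_normcB (h (z + t%:C) - h z) (h (z + t%:C) - h z - d * t%:C).
rewrite opprB addrC subrK normcM nt => a4.
have a5 : normc d * t <= (2 * B / rho + K * t) * t.
  have -> : (2 * B / rho + K * t) * t = B * (2 * t / rho) + K * t ^+ 2 by ring.
  by lra.
move: a5; rewrite ler_pM2r// => a5; lra.
Qed.

(** Borel-Caratheodory for [g = - i s f^n + c], whose real part is [s Im f^n + c]: for
    [s = 1] or [-1] this is the distance to one of the two edges of the strip. *)
Lemma strip_deriv (s c : R) n : `|s| = 1 ->
  (forall z, normc (z - z0) < r -> 0 < s * Im (iter n f z) + c) ->
  normc (dprod lambda n z0) <= 8 * (s * Im (iter n f z0) + c) / r.
Proof.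
move=> s1 pos.
pose g z : C := (0 -i* s) * iter n f z + c%:C.
have Reg z : Re (g z) = s * Im (iter n f z) + c.
  by rewrite /g !(ReD, ReM) /=; ring.
have ga : approximable g.
  have -> : g = (fun z => ((0 -i* s)%:P * 'X + (c%:C)%:P : {poly C}).[iter n f z]).
    by apply: funext => z; rewrite /g !hornerE.
  apply: (@approximable_comp _ (fun z => _.[z]) (iter n f)).
    exact: approximable_poly.
  apply: approximable_iter.
  have -> : f = (fun z : C => ((lambda%:C)%:P * 'X : {poly C}).[cexp z] +
      ('X + (lambda%:C)%:P).[z]).
    by apply: funext => z; rewrite /f_ !hornerE.
  apply: approximable_add; last exact: approximable_poly.
  apply: (@approximable_comp _ (fun z => _.[z]) (@cexp R)).
    exact: approximable_poly.
  exact: approximable_cexp.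
set D := s * Im (iter n f z0) + c.
have rz0 : normc (z0 - z0) < r by rewrite subrr normc0.
have D0 : 0 < D by exact: pos.
have r0 := r_gt0; have r2 : 0 < r / 2 by lra.
have -> : 8 * D / r = 2 * (2 * D) / (r / 2) by field; rewrite gt_eqF.
have DD0 : 0 <= 2 * D by lra.
apply: (cderiv_bound r2 DD0 (cderiv_iter lambda_gt0 n z0)).
move=> w wr.
have := @borel_caratheodory R g (r / 2) z0 (z0 + w) ga.
have -> : z0 + w - z0 = w by rewrite addrAC subrr add0r.
rewrite Reg -/D.
have -> : normc (g (z0 + w) - g z0) = normc (iter n f (z0 + w) - iter n f z0).
  have -> : g (z0 + w) - g z0 = (0 -i* s) * (iter n f (z0 + w) - iter n f z0).
    by rewrite /g; ring.
  by rewrite normcM /= expr0n add0r sqrrN sqrtr_sqr s1 mul1r.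
apply => // u ur; rewrite Reg ltW// pos//; lra.
Qed.

(** Apply [strip_deriv] with the nearer edge, at distance at most [pi]. *)
Lemma dprod_bound n :
  normc (dprod lambda n z0) ^+ 2 <= 4096 / r ^+ 2 * cos2half (iter n f z0).
Proof.
have [k Hk] := strip n; set y := Im (iter n f z0).
have rz0 : normc (z0 - z0) < r by rewrite subrr normc0.
have p0 := pi_gt0 R.
have fin D : 0 < D <= pi -> cos D = - cos y -> normc (dprod lambda n z0) <= 8 * D / r ->
    normc (dprod lambda n z0) ^+ 2 <= 4096 / r ^+ 2 * cos2half (iter n f z0).
  move=> /andP[D0 Dpi] cD dD.
  have D2 : D ^+ 2 <= 32 * (1 + cos y).
    by have := @sqr_le_1Bcos R D; rewrite (ltW D0) Dpi cD opprK; exact.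
  apply: (@le_trans _ _ ((8 * D / r) ^+ 2)).
    by rewrite lerXn2r ?nnegrE ?normc_ge0 ?divr_ge0 ?(ltW r_gt0)// mulr_ge0// ltW.
  have -> : (8 * D / r) ^+ 2 = (64 / r ^+ 2) * D ^+ 2 by field; rewrite gt_eqF.
  have -> : 4096 / r ^+ 2 * cos2half (iter n f z0) = (64 / r ^+ 2) * (32 * (1 + cos y)).
    by rewrite /cos2half -/y; field; rewrite gt_eqF.
  by rewrite ler_wpM2l// divr_ge0// sqr_ge0.
have /andP[y1 y2] := Hk _ rz0; rewrite -/y in y1 y2.
have ck : cos (y - k%:~R * (2 * pi)) = cos y.
  by have [<- _] := cosDsinD_2pi (y - k%:~R * (2 * pi)) k; rewrite subrK.
have [yk|yk] := leP (k%:~R * (2 * pi)) y.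
  apply: (fin (-1 * y + (2 * k%:~R + 1) * pi)).
  - by apply/andP; split; lra.
  - have -> : -1 * y + (2 * k%:~R + 1) * pi = - (y - k%:~R * (2 * pi)) + pi by ring.
    by rewrite cosDpi cosN ck.
  apply: strip_deriv => [|z /Hk]; first by rewrite normrN1.
  by move=> /andP[? ?]; lra.
apply: (fin (1 * y + - ((2 * k%:~R - 1) * pi))).
- by apply/andP; split; lra.
- have -> : 1 * y + - ((2 * k%:~R - 1) * pi) = (y - k%:~R * (2 * pi)) + pi by ring.
  by rewrite cosDpi ck.
apply: strip_deriv => [|z /Hk]; first by rewrite normr1.
by move=> /andP[? ?]; lra.
Qed.

(** The sequence [H] is the square of the hyperbolic derivative of [f^n], up to a constant.
    It is bounded by [dprod_bound] and grows by [f_expands], so the gains [a] tend to 0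
    and the speeds [s] leave the window between [lambda / 2] and [M] for good.  That is
    impossible: above [M] the gain bound makes [cos (Im z)] nearly [-1], so
    the next speed is at most [M]; below [lambda / 2] the speed increases by a
    factor at least [1 + lambda / 2] but cannot exceed [M] in one step. *)
Lemma escape_absurd : False.
Proof.
have l0 := lambda_gt0; have l2 := lambda_lt2.
have rz0 : normc (z0 - z0) < r by rewrite subrr normc0.
pose x n := iter n f z0.
have xb n : ~ basins lambda (x n).
  by move/(basins_iter lambda_gt0 lambda_lt2); exact: escape.
have kx n : 0 < cos2half (x n) by apply: (cos2half_gt0 lambda_gt0 lambda_lt2); exact: xb.
pose s n := speed lambda (x n).
have s0 n : 0 < s n by exact: speed_gt0.
pose a n : R := cos2half (x n) ^+ 2 * (2 * s n + s n ^+ 2).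
have a0 n : 0 <= a n.
  by rewrite mulr_ge0 ?sqr_ge0// addr_ge0 ?sqr_ge0// mulr_ge0// ltW.
pose H n := normc (dprod lambda n z0) ^+ 2 / cos2half (x n).
have H0 : 0 < H 0%N.
  rewrite /H divr_gt0//.
  by rewrite [dprod _ _ _]/= Normc.normc1 expr1n.
have Ha n : H n * (1 + a n) <= H n.+1.
  rewrite /H ler_pdivlMr// [dprod _ _ _]/= normcM exprMn.
  have := f_expands lambda (x n); rewrite -/(s n) -/(a n) => h.
  have G0 : 0 <= normc (dprod lambda n z0) ^+ 2 / cos2half (x n).
    by rewrite divr_ge0 ?sqr_ge0 ?cos2half_ge0.
  have := ler_wpM2l G0 h.
  have -> : normc (dprod lambda n z0) ^+ 2 / cos2half (x n) *
    (cos2half (x n) * normc (1 + lambda%:C * cexp (x n)) ^+ 2) =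
    normc (1 + lambda%:C * cexp (x n)) ^+ 2 * normc (dprod lambda n z0) ^+ 2.
    by field; rewrite gt_eqF.
  apply: le_trans; rewrite -[leLHS]mulrA ler_wpM2l// mulrDl mul1r lerD2l.
  by rewrite ler_piMr ?cos2half_le1.
have HK n : H n <= 4096 / r ^+ 2.
  by rewrite ler_pdivrMr//; exact: dprod_bound.
(* Since [s e^(-s) <= 1], a step from above the window leads to a speed at most [M]. *)
pose M := expR (lambda + 1).
have M1 : lambda / 2 <= M by have := expR_ge1Dx (lambda + 1); rewrite /M; lra.
have [d d0 Hd] := cos2half_window lambda_gt0 lambda_lt2 (ln 2^-1) (ln (M / lambda)).
have eta0 : 0 < Num.min (d ^+ 2 * lambda) 4^-1.
  by rewrite lt_min invr_gt0 ltr0n mulr_gt0// exprn_gt0.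
have [N HN] := growth_bounded H0 a0 Ha HK eta0.
have out n : (N <= n)%N -> s n < lambda / 2 \/ M < s n.
  move=> Nn; have [s1|s1] := ltP (s n) (lambda / 2); first by left.
  right; rewrite ltNge; apply/negP => s2.
  have : d <= cos2half (x n).
    apply: Hd (xb n) _; apply/andP; split.
      rewrite -ler_expR lnK ?posrE ?invr_gt0//; move: s1.
      by rewrite /s /speed ler_pM2l.
    rewrite -ler_expR lnK ?posrE ?divr_gt0 ?expR_gt0// ler_pdivlMr//.
    by rewrite mulrC.
  move=> dk; have := HN _ Nn; rewrite lt_min => /andP[+ _].
  apply/negP; rewrite -leNgt /a ler_pM ?sqr_ge0 ?(ltW l0)//.
    by rewrite lerXn2r ?nnegrE ?cos2half_ge0// ltW.
  by have := sqr_ge0 (s n); lra.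
have sS n : s n.+1 = s n * expR (lambda + s n * (2 * cos2half (x n) - 1)) by exact: speed_f.
have next n : (N <= n)%N -> s n.+1 <= M.
  move=> Nn; rewrite sS; have [sn|sn] := out _ Nn.
    have : s n * expR (lambda + s n * (2 * cos2half (x n) - 1)) <= 1 * M.
      rewrite ler_pM ?expR_ge0 ?(ltW (s0 n))//; first by lra.
      rewrite ler_expR lerD2l; have := cos2half_le1 (x n) => k1.
      have : s n * (2 * cos2half (x n) - 1) <= s n * 1 by rewrite ler_wpM2l ?(ltW (s0 n))//; lra.
      by lra.
    by rewrite mul1r.
  have ks : cos2half (x n) * s n < 2^-1.
    have := HN _ Nn; rewrite lt_min => /andP[_ an].
    have : (cos2half (x n) * s n) ^+ 2 < 2^-1 ^+ 2.
      rewrite exprMn; apply: le_lt_trans (lt_le_trans an _); last by lra.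
      by rewrite ler_wpM2l ?sqr_ge0// lerDr mulr_ge0// ltW.
    by rewrite ltr_pXn2r// ?nnegrE ?invr_ge0 ?ler0n// mulr_ge0 ?cos2half_ge0// ltW.
  have h : expR (lambda + s n * (2 * cos2half (x n) - 1)) <= expR (lambda + 1) * expR (- s n).
    by rewrite -expRD ler_expR; lra.
  have h2 : s n * expR (- s n) <= 1.
    have -> : 1 = expR (s n) * expR (- s n) by rewrite -expRD subrr expR0.
    by rewrite ler_wpM2r ?expR_ge0//; have := expR_ge1Dx (s n); lra.
  have := ler_wpM2l (ltW (s0 n)) h => /le_trans; apply.
  by rewrite mulrCA ler_piMr// expR_ge0.
have low n : s (N.+1 + n)%N < lambda / 2.
  have Nn : (N <= N + n)%N by rewrite leq_addr.
  have := next _ Nn; rewrite addSn.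
  have [//|] := out (N + n).+1%N (leqW Nn).
  by move=> /lt_le_trans h /h; rewrite ltxx.
have [|||||N' HN'] := @growth_bounded R (fun n => s (N.+1 + n)%N) (fun=> lambda / 2)
  (lambda / 2) _ _ _ _ (lambda / 2).
- exact: s0.
- by move=> _; lra.
- move=> n; rewrite addnS sS ler_pM2l//; apply: le_trans (expR_ge1Dx (lambda / 2)) _.
  rewrite ler_expR; have := low n; set t := s _ => tl.
  have := cos2half_ge0 (x (N.+1 + n)%N) => k0.
  have : 0 <= t * cos2half (x (N.+1 + n)%N) by rewrite mulr_ge0// ltW//; exact: s0.
  by lra.
- by move=> n; exact/ltW/low.
- by lra.
by have := HN' _ (leqnn _); rewrite ltxx.
Qed.

End EmptyInterior.

Lemma basins_dense z0 (r : R) : 0 < r -> exists2 z, normc (z - z0) < r & basins lambda z.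
Proof.
move=> r0; apply: contrapT => H; apply: (@escape_absurd z0 r r0) => z zr zb.
by apply: H; exists z.
Qed.

End Density.

(** * The Fatou set is the union of the basins *)

Section Normality.
Context {R : realType} (lambda : R).
Hypotheses (lambda_gt0 : 0 < lambda) (lambda_lt2 : lambda < 2).
Local Notation C := (plane R).
Local Notation f := (@f_ R lambda).
Implicit Types (z w d : C) (k j : int) (n m : nat).

Definition spread (x : R) : R := Num.sqrt (1 + x ^+ 2).

Lemma spread_ge1 x : 1 <= spread x.
Proof. by rewrite -[leLHS]sqrtr1 ler_sqrt ?lerDl ?sqr_ge0// addr_ge0 ?sqr_ge0. Qed.

Lemma spread_le x : 0 <= x -> spread x <= 1 + x.
Proof.
move=> x0; have x1 : 0 <= 1 + x by lra.
rewrite -[leRHS](ger0_norm x1) -sqrtr_sqr ler_sqrt ?sqr_ge0//.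
by rewrite sqrrD; lra.
Qed.

Lemma chordal_le z w : chordal (Some z) (Some w) <= 2 * normc (z - w).
Proof.
rewrite /chordal -!/(spread _).
have s1 := spread_ge1 (normc z); have s2 := spread_ge1 (normc w).
rewrite ler_pdivrMr; last by rewrite mulr_gt0; lra.
rewrite ler_peMr ?mulr_ge0 ?normc_ge0//; nra.
Qed.

Lemma chordal_ge z w : 2 * normc (z - w) <=
  chordal (Some z) (Some w) * ((1 + normc z) * (1 + normc w)).
Proof.
rewrite /chordal -!/(spread _).
have s1 := spread_ge1 (normc z); have s2 := spread_ge1 (normc w).
rewrite mulrAC ler_pdivlMr; last by rewrite mulr_gt0; lra.
rewrite ler_wpM2l ?mulr_ge0 ?normc_ge0//.
by rewrite ler_pM ?spread_le ?normc_ge0//; lra.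
Qed.

Lemma chordal_inf_ge z : 2 <= chordal (Some z) None * (1 + normc z).
Proof.
rewrite /chordal -!/(spread _); have s1 := spread_ge1 (normc z).
rewrite mulrAC ler_pdivlMr; last by lra.
by rewrite ler_wpM2l// spread_le// normc_ge0.
Qed.

(** Uniqueness of limits across the two metrics; in particular the chordal limit is not the
    point at infinity. *)
Lemma chordal_limit (u : nat -> C) p (q : sphere R) :
  (forall e : R, 0 < e -> \forall n \near \oo, normc (u n - p) < e) ->
  (forall e : R, 0 < e -> \forall n \near \oo, chordal (Some (u n)) q < e) ->
  q = Some p.
Proof.
move=> up uq; pose B := 2 + normc p.
have B0 : 0 < B by have := normc_ge0 p; rewrite /B; lra.
have uB : \forall n \near \oo, 1 + normc (u n) <= B.
  near=> n; have : normc (u n - p) < 1 by near: n; exact: up.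
  have := le_normcD (u n - p) p; rewrite subrK /B; lra.
case: q uq => [w|] uq; last first.
  have [n [n1 n2]] : exists n, 1 + normc (u n) <= B /\ chordal (Some (u n)) None < B^-1.
    have Bi : 0 < B^-1 by rewrite invr_gt0.
    by near \oo => n; exists n; split; near: n; [exact: uB|exact: uq].
  have := chordal_inf_ge (u n); set c := chordal _ _ in n2 *.
  have cB : c * B < 1 by rewrite -ltr_pdivlMr// mul1r.
  have c0 : 0 <= c by rewrite divr_ge0// sqrtr_ge0.
  by have := ler_wpM2l c0 n1 => h1 h2; exfalso; lra.
congr Some; apply/eqP; rewrite -subr_eq0; apply/eqP/normc_eq0/eqP.
rewrite eq_le normc_ge0 andbT; apply/ler_addgt0Pr => e e0; rewrite add0r.
pose D := B * (1 + normc w).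
have D0 : 0 < D by rewrite mulr_gt0//; have := normc_ge0 w; lra.
have e2 : 0 < e / 2 by lra.
have [n [[n1 n2] n3]] : exists n, (1 + normc (u n) <= B /\ normc (u n - p) < e / 2) /\
    chordal (Some (u n)) (Some w) < e / D.
  have ed : 0 < e / D by rewrite divr_gt0.
  near \oo => n; exists n; do !split; near: n; [exact: uB|exact: up|exact: uq].
have := chordal_ge (u n) w; set c := chordal _ _ in n3 *.
have cB : c * D < e by rewrite -ltr_pdivlMr.
have c0 : 0 <= c by rewrite divr_ge0 ?mulr_ge0 ?normc_ge0 ?sqrtr_ge0.
have h : c * ((1 + normc (u n)) * (1 + normc w)) <= c * D.
  by rewrite ler_wpM2l// ler_wpM2r//; have := normc_ge0 w; lra.
have := le_normc_tri w (u n) p; rewrite (normcBC w (u n)); lra.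
Unshelve. all: by end_near. Qed.

(** The fixed points are isolated in the sphere: a point within distance 1 of [fixpt j] that
    is chordally very close to some [fixpt k] can only be close to [fixpt j]. *)
Lemma chordal_fixpt_separated j k w (e : R) : normc (w - fixpt j) <= 1 ->
  e <= 1 -> chordal (Some w) (Some (fixpt k)) < e / (2 + normc (fixpt j : C)) ^+ 2 ->
  normc (w - fixpt j) < e.
Proof.
set P := normc (fixpt j : C) => wj e1; have P0 : 0 <= P by exact: normc_ge0.
have B0 : 0 < (2 + P) ^+ 2 by rewrite exprn_gt0//; lra.
set c := chordal _ _; rewrite ltr_pdivlMr// => ce.
have c0 : 0 <= c by rewrite divr_ge0 ?mulr_ge0 ?normc_ge0 ?sqrtr_ge0.
have wP : 1 + normc w <= 2 + P.
  by have := le_normcD (w - fixpt j) (fixpt j); rewrite subrK -/P; lra.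
have := chordal_ge w (fixpt k); rewrite -/c.
have [->|kj] := eqVneq k j.
  rewrite -/P => h.
  have : c * ((1 + normc w) * (1 + P)) <= c * (2 + P) ^+ 2.
    by rewrite ler_wpM2l// expr2 ler_pM//; have := normc_ge0 w; lra.
  have := normc_ge0 (w - fixpt j); lra.
have := @fixpt_dist R _ _ kj; set D := normc (fixpt k - fixpt j) => D4.
have h1 : D - 1 <= normc (w - fixpt k).
  have := le_normc_tri (fixpt k) w (fixpt j); rewrite -/D (normcBC (fixpt k) w); lra.
have h2 : 1 + normc (fixpt k : C) <= (2 + P) * D.
  have := le_normcD (fixpt k - fixpt j) (fixpt j : C); rewrite subrK -/D -/P.
  have : P <= P * D by rewrite ler_peMr//; lra.
  by lra.
have h3 : c * ((1 + normc w) * (1 + normc (fixpt k : C))) <= c * (2 + P) ^+ 2 * D.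
  rewrite -mulrA ler_wpM2l// expr2 -mulrA ler_pM//; have := normc_ge0 w.
  - by lra.
  - by have := normc_ge0 (fixpt k : C); lra.
have h4 : c * (2 + P) ^+ 2 * D <= 1 * D by rewrite ler_wpM2r//; lra.
lra.
Qed.

Lemma strictly_increasing_choice (P : nat -> Prop) :
  (forall n, exists m, (n <= m)%N /\ P m) ->
  exists2 s : nat -> nat, {homo s : m n / (m < n)%N} & forall n, P (s n).
Proof.
move=> /choice[g Hg].
pose s := fix s n := if n is n'.+1 then g (s n').+1 else g 0%N.
exists s.
  by apply: homo_ltn => [x y z|n]; [exact: ltn_trans|have [] := Hg (s n).+1].
by case=> [|n]; [have [] := Hg 0%N|have [] := Hg (s n).+1].
Qed.

(** Near a point of a basin the iterates converge uniformly to the fixed point.  A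
    sequence of iterates either repeats one iterate infinitely often, or its
    exponents tend to infinity. *)
Lemma basins_sub_Fatou : basins lambda `<=` Fatou f.
Proof.
move=> z [k [N zN]]; have r0 := radius_gt0 lambda_gt0 lambda_lt2.
exists [set w | normc (iter N f w - fixpt k) < radius lambda]; split => //.
  apply/plane_openP => w /= wN.
  have e0 : 0 < radius lambda - normc (iter N f w - fixpt k) by rewrite subr_gt0.
  have [e' e'0 H] := cderiv_eps (cderiv_iter lambda_gt0 N w) e0.
  exists e' => // w' /H; have := le_normc_tri (iter N f w') (iter N f w) (fixpt k); lra.
move=> u uit.
have /choice[m um] : forall n, exists m, u n = iter m f.
  by move=> n; have [m _ ->] := uit n; exists m.
have [[v vinf]|H] := pselect (exists v, forall n, exists n', (n <= n')%N /\ m n' = v).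
  have [s sh sv] := strictly_increasing_choice vinf.
  exists s => //; exists (fun w => Some (iter v f w)) => K _ _ e e0.
  apply: nearW => n w _; rewrite um sv.
  by apply: le_lt_trans (chordal_le _ _) _; rewrite subrr normc0 mulr0.
have mlarge M : exists n0, forall n, (n0 <= n)%N -> (M <= m n)%N.
  elim: M => [|M [n0 IH]]; first by exists 0%N.
  have : exists n1, forall n', ~ ((n1 <= n')%N /\ m n' = M).
    move: H => /forallNP /(_ M) /existsNP[n1 /forallNP Hn1].
    by exists n1.
  move=> [n1 Hn1]; exists (maxn n0 n1) => n; rewrite geq_max => /andP[n0n n1n].
  by rewrite ltn_neqAle IH// andbT eq_sym; apply/eqP => mM; case: (Hn1 n).
exists id => //; exists (fun=> Some (fixpt k)) => K _ KU e e0.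
have e2 : 0 < e / 2 by lra.
have [N' HN'] := rate_cvg lambda_gt0 lambda_lt2 e2.
have [n0 Hn0] := mlarge (N + N')%N.
exists n0 => // n /= n0n w Kw; rewrite um.
have Nm : (N <= m n)%N by have := Hn0 _ n0n; lia.
apply: le_lt_trans (chordal_le _ _) _.
have [h _] := iter_contract lambda_gt0 lambda_lt2 (m n - N)%N (KU _ Kw).
rewrite -iterD subnK// in h.
have NN : (N' <= m n - N)%N by have := Hn0 _ n0n; lia.
have := HN' _ NN => h2.
have : rate lambda ^+ (m n - N) * normc (iter N f w - fixpt k) <=
    rate lambda ^+ (m n - N) * radius lambda.
  by rewrite ler_wpM2l ?exprn_ge0 ?rate_ge0// ltW//; exact: KU.
by lra.
Qed.

Lemma square_compact (a b r : R) :
  compact ((fun xy : R * R => (xy.1 +i* xy.2 : C)) @`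
    (`[a - r, a + r]%classic `*` `[b - r, b + r]%classic)).
Proof.
apply: continuous_compact; last by apply: compact_setX; exact: segment_compact.
exact/continuous_subspaceT/continuous_complex.
Qed.

(** The values [psi z] of the distance from a late iterate to [fixpt j] avoid the interval
    between [e] and 1 on the basins, hence everywhere near [z0] by density.  Since
    [psi z1 < e] at a nearby point [z1] of a basin, [psi z0 <= e] by connectedness. *)
Lemma Fatou_sub_basins : Fatou f `<=` basins lambda.
Proof.
move=> z0 [U [/plane_openP Uo Uz0 Unorm]].
have [r r0 rU] := Uo _ Uz0.
have [|s sh [g Hg]] := Unorm (fun n => iter n.+1 f).
  by move=> n; exists n.+1.
have sn n : (n <= s n)%N by elim: n => // n IH; rewrite (leq_ltn_trans IH)// sh.
pose r' := r / 4; have r'0 : 0 < r' by rewrite /r'; lra.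
set K := (fun xy : R * R => (xy.1 +i* xy.2 : C)) @`
    (`[Re z0 - r', Re z0 + r']%classic `*` `[Im z0 - r', Im z0 + r']%classic).
have Kc : compact K by exact: square_compact.
have KU : K `<=` U.
  move=> _ [[x y] [/= + +] <-]; rewrite !in_itv/= => /andP[x1 x2] /andP[y1 y2].
  apply: rU; apply: le_lt_trans (normc_le_ReIm _) _.
  rewrite !(ReD, ImD, ReN, ImN) /=.
  have hx : `|x - Re z0| <= r' by rewrite ler_norml; apply/andP; split; lra.
  have hy : `|y - Im z0| <= r' by rewrite ler_norml; apply/andP; split; lra.
  by move: hx hy; rewrite /r'; lra.
have KB z : normc (z - z0) < r' -> K z.
  move=> zr; exists (Re z, Im z); last by case: z zr.
  have := le_lt_trans (normr_Re_le _) zr; have := le_lt_trans (normr_Im_le _) zr.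
  rewrite ReD ImD ReN ImN !ltr_norml => /andP[? ?] /andP[? ?].
  by split; rewrite /= in_itv/=; apply/andP; split; lra.
have {}Hg := Hg K Kc KU.
have [z1 z1r [j z1j]] := basins_dense lambda_gt0 lambda_lt2 z0 r'0.
have gE i z : normc (z - z0) < r' -> basin lambda i z -> g z = Some (fixpt i).
  move=> zr zi; apply: (@chordal_limit (fun n => iter (s n).+1 f z)) => e e0.
    have [N HN] := basin_cvg lambda_gt0 lambda_lt2 zi e0.
    by exists N => // n /= Nn; apply: (HN (s n).+1); rewrite (leq_trans Nn)// (leq_trans (sn _)).
  by apply: filterS (Hg _ e0) => n; apply; exact: KB.
have rd0 := radius_gt0 lambda_gt0 lambda_lt2; have g1 := gap_le1 lambda.
pose e := radius lambda / 2.
have e0 : 0 < e by rewrite /e; lra.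
have e1 : e < 1 by move: g1; rewrite /e /radius; lra.
set P := normc (fixpt j : C); have P0 : 0 <= P by exact: normc_ge0.
have ed : 0 < e / (2 + P) ^+ 2 by rewrite divr_gt0// exprn_gt0//; lra.
have [N HN] := basin_cvg lambda_gt0 lambda_lt2 z1j e0.
have [n [nN Hn]] : exists n, (N <= n)%N /\
    forall z, K z -> chordal (Some (iter (s n).+1 f z)) (g z) < e / (2 + P) ^+ 2.
  near \oo => n; exists n; split; near: n; first exact: nbhs_infty_ge.
  exact: Hg.
set F := iter (s n).+1 f in Hn.
pose psi z := normc (F z - fixpt j).
have psiB z : normc (z - z0) < r' -> basins lambda z -> psi z <= 1 -> psi z < e.
  move=> zr [i zi] z1'; have := Hn _ (KB _ zr); rewrite (gE i)//.
  by apply: chordal_fixpt_separated => //; exact: ltW.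
have psi_eps u (e1' : R) : 0 < e1' -> exists2 e' : R, 0 < e' &
    forall u', normc (u' - u) < e' -> `|psi u' - psi u| < e1'.
  move=> e10; have [e' e'0 H] := cderiv_eps (cderiv_iter lambda_gt0 (s n).+1 u) e10.
  exists e' => // u' /H; apply: le_lt_trans; rewrite /psi -/F.
  rewrite ler_norml lerNl opprB !lerBlDl.
  have := le_normc_tri (F u') (F u) (fixpt j); have := le_normc_tri (F u) (F u') (fixpt j).
  by rewrite (normcBC (F u) (F u')) => ? ?; apply/andP; split; lra.
have gapB z : normc (z - z0) < r' -> ~ (e < psi z < 1).
  move=> zr /andP[ez z1'].
  have d0 : 0 < Num.min (psi z - e) (1 - psi z) by rewrite lt_min !subr_gt0 ez.
  have [e' e'0 He'] := psi_eps z _ d0.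
  have t0 : 0 < Num.min e' (r' - normc (z - z0)) by rewrite lt_min e'0 subr_gt0.
  have [w] := basins_dense lambda_gt0 lambda_lt2 z t0.
  rewrite lt_min => /andP[we wr] wb.
  have wr' : normc (w - z0) < r' by have := le_normc_tri w z z0; lra.
  have := He' _ we; rewrite lt_min !ltr_norml => /andP[/andP[a1 a2] /andP[a3 a4]].
  by have := psiB w wr' wb; lra.
have psi1 : psi z1 < e by apply: (HN (s n).+1); rewrite (leq_trans nN)// (leq_trans (sn _)).
have psi0 : psi z0 <= e.
  rewrite leNgt; apply/negP => ez0.
  have z0r : normc (z0 - z0) < r' by rewrite subrr normc0.
  have v1 : 1 <= psi z0.
    by rewrite leNgt; apply/negP => v1; case: (gapB z0) => //; rewrite ez0 v1.
  have [||t /andP[t0 t1] tv] := @segment_IVT R psi z1 z0 ((e + 1) / 2).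
  - exact: psi_eps.
  - by apply/andP; split; lra.
  apply: (gapB (z1 + t%:C * (z0 - z1))); last by rewrite tv; apply/andP; split; lra.
  have -> : z1 + t%:C * (z0 - z1) - z0 = (1 - t)%:C * (z1 - z0).
    by rewrite rmorphB/= rmorph1; ring.
  have t10 : 0 <= 1 - t by lra.
  rewrite normcM normc_real ger0_norm//; apply: le_lt_trans z1r.
  by rewrite ler_piMl ?normc_ge0//; lra.
exists j; exists (s n).+1; apply: le_lt_trans psi0 _.
by rewrite /e; lra.
Unshelve. all: by end_near. Qed.

Lemma FatouE : Fatou f = basins lambda.
Proof. by apply/seteqP; split; [exact: Fatou_sub_basins|exact: basins_sub_Fatou]. Qed.

End Normality.

(** * Fatou components *)

Section Components.
Context {R : realType} (lambda : R).
Hypotheses (lambda_gt0 : 0 < lambda) (lambda_lt2 : lambda < 2).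
Local Notation C := (plane R).
Local Notation f := (@f_ R lambda).
Implicit Types (z w d : C) (k j : int) (n m : nat).

(** Inside the component a basin is open, and closed as the complement of the others. *)
Lemma component_sub_basin k z : basin lambda k z ->
  connected_component (basins lambda) z `<=` basin lambda k.
Proof.
move=> kz; set V := connected_component _ z.
have Vb : V `<=` basins lambda by exact: connected_component_sub.
have zV : V z by apply: connected_component_refl; exists k.
have <- : V `&` basin lambda k = V; last by move=> w [].
have Vc : connected V by exact: component_connected.
apply: Vc.
- by exists z.
- by exists (basin lambda k) => //; exact: basin_open.
exists (~` \bigcup_(j in [set j | j != k]) basin lambda j).
  by apply: open_closedC; apply: bigcup_open => j _; exact: basin_open.
apply/seteqP; split=> w [Vw].
  move=> kw; split=> // -[j /= jk jw].
  by move: jk; rewrite (basin_disjoint lambda_gt0 lambda_lt2 jw kw) eqxx.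
move=> H; split=> //; have [j jw] := Vb _ Vw.
have [<-//|jk] := eqVneq j k.
by case: H; exists j.
Qed.

(** The immediate basin of [fixpt k]. *)
Definition immediate k : set C := connected_component (basins lambda) (fixpt k).

Lemma fixpt_basins k : basins lambda (fixpt k).
Proof. by exists k; exact: basin_fixpt. Qed.

Lemma immediate_fixpt k : immediate k (fixpt k).
Proof. by apply: connected_component_refl; exact: fixpt_basins. Qed.

Lemma ball_sub_immediate k z : normc (z - fixpt k) < radius lambda -> immediate k z.
Proof.
move=> zr.
pose seg (t : R) : C := fixpt k + t%:C * (z - fixpt k).
have segc : continuous seg by exact: continuous_segment.
have := @connected_component_max _ (basins lambda) (seg @` `[0, 1]%classic) (fixpt k).
apply.
- by exists 0; rewrite /= ?in_itv/= ?lexx ?ler01// /seg rmorph0 mul0r addr0.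
- move=> _ [t /= + <-]; rewrite in_itv/= => /andP[t0 t1].
  exists k; exists 0%N; rewrite [iter _ _ _]/= /seg addrAC subrr add0r normcM normc_real.
  by rewrite ger0_norm// (le_lt_trans _ zr)// ler_piMl ?normc_ge0.
- apply: connected_continuous_connected; first exact: segment_connected.
  exact: continuous_subspaceT.
- by exists 1; rewrite /= ?in_itv/= ?lexx ?ler01// /seg rmorph1 mul1r addrC subrK.
Qed.

Lemma iter_image_immediate n k z (V : set C) : connected V -> V `<=` basins lambda ->
  V z -> immediate k (iter n f z) -> iter n f @` V `<=` immediate k.
Proof.
move=> Vc Vb Vz kz; rewrite /immediate (same_connected_component kz).
apply: connected_component_max; first by exists z.
- by move=> _ [w Vw <-]; apply/(basins_iter lambda_gt0 lambda_lt2); exact: Vb.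
- apply: connected_continuous_connected => //; apply: continuous_subspaceT.
  exact: continuous_iter.
Qed.

Lemma immediate_component k : Fatou_component f (immediate k).
Proof.
by exists (fixpt k); rewrite (FatouE lambda_gt0 lambda_lt2)//; exact: fixpt_basins.
Qed.

Lemma immediate_attracting k : attracting_domain f (immediate k).
Proof.
split.
  split; first exact: immediate_component.
  exists 1%N => //; split; first exact: immediate_component.
  apply: (@iter_image_immediate 1 k (fixpt k)).
  - exact: component_connected.
  - exact: connected_component_sub.
  - exact: immediate_fixpt.
  - by rewrite /= f_fixpt; exact: immediate_fixpt.
exists (fixpt k); first exact: immediate_fixpt.
exists 1%N; split => //; first exact: f_fixpt.
exists (dprod lambda 1 (fixpt k)).
  by apply: cderiv_is_derive; exact: cderiv_iter.
have -> : dprod lambda 1 (fixpt k) = (1 - lambda)%:C.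
  by rewrite /= cexp_fixpt mulr1 mulrN1 rmorphB.
rewrite plane_normE normc_real ltcR ltr_norml.
by apply/andP; split; move: lambda_gt0 lambda_lt2; lra.
Qed.

Lemma eventually_immediate z : basins lambda z -> exists n k, (0 < n)%N /\
  is_nth_component f (connected_component (basins lambda) z) n (immediate k).
Proof.
move=> zb; have [k kz] := zb; have [n Hn] := basin_near lambda_gt0 lambda_lt2 kz.
exists n.+1, k; split=> //; split; first exact: immediate_component.
apply: (@iter_image_immediate _ _ z).
- exact: component_connected.
- exact: connected_component_sub.
- exact: connected_component_refl.
- by apply: ball_sub_immediate; have [] := Hn n.+1 (leqnSn n).
Qed.

Lemma immediate_inj k j : immediate k = immediate j -> k = j.
Proof.
move=> kj; have kk : basin lambda k (fixpt k) by exact: basin_fixpt.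
have jj : basin lambda j (fixpt j) by exact: basin_fixpt.
have := immediate_fixpt k; rewrite kj => /(component_sub_basin jj) jk.
exact: (basin_disjoint lambda_gt0 lambda_lt2 kk jk).
Qed.

(** The immediate basins are pairwise distinct. *)
Lemma infinite_immediate : infinite_set [set U | attracting_domain f U].
Proof.
move=> fin; apply: infinite_nat.
pose g (V : set C) : nat := xget 0%N [set n : nat | V = immediate n%:Z].
apply: sub_finite_set (finite_image g fin) => n _.
exists (immediate n%:Z); first exact: immediate_attracting.
have : [set m : nat | immediate n%:Z = immediate m%:Z] (g (immediate n%:Z)).
  by apply: xgetPex; exists n.
by move=> /immediate_inj [].
Qed.

End Components.

Theorem mainTheorem5 (R : realType) (lambda : R)
    (lambda_gt0 : 0 < lambda) (lambda_lt2 : lambda < 2) :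
  [/\ infinite_set [set U | attracting_domain (f_ lambda) U],
      Fatou (f_ lambda) =
        \bigcup_(V in [set V | attracting_domain (f_ lambda) V \/
          exists2 U, attracting_domain (f_ lambda) U &
                     iterated_preimage (f_ lambda) U V]) V &
      ~ exists W, Baker_wandering_domain (f_ lambda) W].
Proof.
split.
- exact: infinite_immediate.
- have sub V : Fatou_component (f_ lambda) V -> V `<=` Fatou (f_ lambda).
    by move=> [z _ ->]; exact: connected_component_sub.
  apply/seteqP; split => z.
    rewrite {1}(FatouE lambda_gt0 lambda_lt2) => zb.
    have [n [k [n0 Vn]]] := eventually_immediate lambda_gt0 lambda_lt2 zb.
    have Vc : Fatou_component (f_ lambda) (connected_component (basins lambda) z).
      by exists z; rewrite (FatouE lambda_gt0 lambda_lt2).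
    exists (connected_component (basins lambda) z); last exact: connected_component_refl.
    right; exists (immediate lambda k); first exact: immediate_attracting.
    by split => //; [exact: immediate_component|exists n].
  move=> [V [[[Vc _] _]|[U _ [_ Vc _]]] Vz]; exact: sub Vc _ Vz.
- move=> [W [[Wc Wnp Wnpp] _]]; apply: Wnpp; split => //.
  have [z zF WE] := Wc; rewrite (FatouE lambda_gt0 lambda_lt2) in zF WE.
  have [n [k [n0 Wn]]] := eventually_immediate lambda_gt0 lambda_lt2 zF.
  exists n, (immediate lambda k); split; [by []|by rewrite WE|].
  by have [] := immediate_attracting lambda_gt0 lambda_lt2 k.
Qed.
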